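(* Every $2K_2$-free graph $G$ satisfies $h_d(G) \geq \chi(G)$. That is, if $G$ is a finite simple graph with no induced subgraph isomorphic to $2K_2$, then $G$ contains a dominating $K_{\chi(G)}$ minor.
   Context: All graphs are finite and simple. $\chi(G)$ denotes the chromatic number of $G$. $2K_2$ is the graph consisting of two disjoint edges (the complement of the cycle $C_4$); a graph is $H$-free if it has no induced subgraph isomorphic to $H$. A graph $G$ contains a dominating $K_t$ minor if there exists a sequence $(T_1,\dots,T_t)$ of pairwise disjoint non-empty connected subgraphs of $G$ such that for all $1 \le i < j \le t$, every vertex of $T_j$ has a neighbor in $T_i$. The dominating Hadwiger number $h_d(G)$ is the largest integer $t$ such that $G$ contains a dominating $K_t$ minor. *)

(* Defs.v *)
From HB Require Import structures.
From mathcomp Require Import all_boot.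

Set Implicit Arguments.
Unset Strict Implicit.
Unset Printing Implicit Defensive.

Record sgraph := SGraph {
  vertex :> finType;
  adj : rel vertex;
  adj_sym : symmetric adj;
  adj_irr : irreflexive adj }.

Section Induced.
Variables (G : sgraph) (S : {set G}).

Definition induced_adj : rel {x : G | x \in S} :=
  fun u v => adj (val u) (val v).

Lemma induced_adj_sym : symmetric induced_adj.
Proof. by move=> u v; exact: adj_sym. Qed.

Lemma induced_adj_irr : irreflexive induced_adj.
Proof. by move=> u; exact: adj_irr. Qed.

Definition induced : sgraph := SGraph induced_adj_sym induced_adj_irr.

End Induced.

Definition isomorphic (G H : sgraph) : Prop :=
  exists f : G -> H, bijective f /\ forall x y, adj (f x) (f y) = adj x y.

Definition free (H G : sgraph) : Prop :=
  forall S : {set G}, ~ isomorphic (induced S) H.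

(* The first component of a vertex selects one of the two disjoint edges, the
   second one of its ends. *)
Definition twoK2_adj : rel (bool * bool) :=
  fun u v => (u.1 == v.1) && (u.2 != v.2).

Lemma twoK2_adj_sym : symmetric twoK2_adj.
Proof. by move=> u v; rewrite /twoK2_adj eq_sym [v.2 == _]eq_sym. Qed.

Lemma twoK2_adj_irr : irreflexive twoK2_adj.
Proof. by move=> u; rewrite /twoK2_adj !eqxx. Qed.

Definition twoK2 : sgraph := SGraph twoK2_adj_sym twoK2_adj_irr.

Section Chromatic.
Variable G : sgraph.

Definition colorable (k : nat) : bool :=
  [exists f : {ffun G -> 'I_k}, forall x, forall y, adj x y ==> (f x != f y)].

Lemma colorable_exists : exists k, colorable k.
Proof.
exists #|G|; apply/existsP; exists [ffun x => enum_rank x].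
apply/forallP=> x; apply/forallP=> y; apply/implyP=> xy; rewrite !ffunE.
by apply: contraTneq xy => /enum_rank_inj->; rewrite adj_irr.
Qed.

Definition chi : nat := ex_minn colorable_exists.

End Chromatic.

Section Dominating.
Variable G : sgraph.

(* A vertex set and a set of edges, an edge being the set of its two ends;
   [is_subgraph] selects those pairs that are subgraphs of G. Subgraphs are
   not required to be induced. *)
Definition presubgraph : finType := ({set G} * {set {set G}})%type.

Definition verts (T : presubgraph) : {set G} := T.1.
Definition edges (T : presubgraph) : {set {set G}} := T.2.

Definition is_subgraph (T : presubgraph) : bool :=
  [forall A in edges T, exists x in verts T, exists y in verts T,
     adj x y && (A == [set x; y])].

Definition sub_adj (T : presubgraph) : rel G :=
  fun x y => [set x; y] \in edges T.

Definition sub_connected (T : presubgraph) : bool :=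
  [forall x in verts T, forall y in verts T, connect (sub_adj T) x y].

Definition is_dominating_model (t : nat) (T : 'I_t -> presubgraph) : bool :=
  [&& [forall i, [&& is_subgraph (T i), verts (T i) != set0
                   & sub_connected (T i)]],
      [forall i, forall j, (i != j) ==> [disjoint verts (T i) & verts (T j)]]
    & [forall i : 'I_t, forall j : 'I_t, (i < j) ==>
         [forall y in verts (T j), exists x in verts (T i), adj y x]]].

Definition dominating_minor (t : nat) : bool :=
  [exists T : {ffun 'I_t -> presubgraph}, is_dominating_model T].

Lemma dominating_minor_exists : exists t, dominating_minor t.
Proof.
exists 0; apply/existsP; exists [ffun=> (set0, set0)].
by apply/and3P; split; apply/forallP=> -[].
Qed.

Lemma dominating_minor_bound t : dominating_minor t -> t <= #|G|.
Proof.
case/existsP=> T /and3P[/forallP Tok /forallP Tdisj _].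
have Tne i : exists x, x \in verts (T i).
  by case/and3P: (Tok i) => _ /set0Pn.
pose r i := xchoose (Tne i).
have r_inj : injective r.
  move=> i j rij; apply/eqP; apply: contraT => nij.
  move/forallP/(_ j)/implyP/(_ nij): (Tdisj i) => /disjointFr/(_ (xchooseP (Tne i))).
  by rewrite -/(r i) rij (xchooseP (Tne j)).
by rewrite -[t]card_ord; exact: leq_card r_inj.
Qed.

Definition hd : nat := ex_maxn dominating_minor_exists dominating_minor_bound.

End Dominating.

(* Main.v *)
Require Import Defs.
From mathcomp Require Import all_boot.
From mathcomp Require Import zify.
From Stdlib Require Import Classical.

(* Let U be a vertex set of least size that has no dominating model with
   k = chi(U) parts. If R is a nonempty subset of U that contains p disjoint
   connected sets, each of which dominates U - R and the later ones, then
   chi(U - R) < k - p; in particular R is not a union of p independent sets.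

   Let I be a largest independent subset of U. As G is 2K2-free, two nonadjacent
   vertices outside I have comparable neighbourhoods in I, and these are not
   empty. Choosing R = I + (two or three vertices) one finds that U - I has no
   three independent vertices and that some vertex a outside I has only one
   neighbour i in I. Colour classes in U - I now have at most two vertices, so
   the colourings are matchings of the complement, and U - I is critical. By
   Gallai's lemma the co-component C of a satisfies 2 chi(C) = |C| + 1, which
   turns the condition on chi(U - R) into a condition on cardinals: p sets may
   use all of I0 = I - i and 2p - 1 vertices of J = C + i.

   Let K consist of i and of the vertices of C whose only neighbour in I is i,
   and M = J - K. Then K is a clique without edges to I0, and each vertex of M
   has exactly one nonneighbour in K. The choices p = 2 and p = 3 show that some
   vertex of I0 is complete to M and that the complement of G[J] has diameter 2.
   As in a Moore graph, it follows that |J| = |K|^2, so |K| is even because |J|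
   is. Finally K is split into pairs; for a vertex x of M, each nonneighbour y of
   x in M is paired with a vertex of M that has the same nonneighbour in K as y;
   and x is left as a part of its own. *)

Set Implicit Arguments.
Unset Strict Implicit.
Unset Printing Implicit Defensive.


(** * Independent sets and the chromatic number of a vertex set *)

Section Colouring.
Variable G : sgraph.
Implicit Types (S A B X T : {set G}) (x y z : G).

Lemma adjC x y : adj x y = adj y x.
Proof. exact: adj_sym. Qed.

Definition indep S := [forall x in S, forall y in S, ~~ adj x y].

Lemma indepP S : reflect {in S &, forall x y, ~~ adj x y} (indep S).
Proof.
apply: (iffP forall_inP) => [h x y xS yS|h x xS].
  by move/forall_inP: (h x xS); apply.
by apply/forall_inP=> y yS; apply: h.
Qed.

Lemma indepS A B : A \subset B -> indep B -> indep A.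
Proof.
by move=> /subsetP sAB /indepP iB; apply/indepP=> x y /sAB xB /sAB; apply: iB.
Qed.

Lemma indepU1 x A : indep A -> {in A, forall y, ~~ adj x y} -> indep (x |: A).
Proof.
move=> /indepP iA h; apply/indepP=> y z /setU1P[->|yA] /setU1P[->|zA].
- by rewrite adj_irr.
- exact: h.
- by rewrite adjC; apply: h.
- exact: iA.
Qed.

Lemma indep1 x : indep [set x].
Proof. by apply/indepP=> y z /set1P-> /set1P->; rewrite adj_irr. Qed.

Lemma indep2 x y : ~~ adj x y -> indep [set x; y].
Proof.
by move=> nxy; apply: indepU1 (indep1 y) _ => z /set1P->.
Qed.

Lemma indep3 x y z : ~~ adj x y -> ~~ adj x z -> ~~ adj y z ->
  indep [set x; y; z].
Proof.
move=> nxy nxz nyz; rewrite -setUA; apply: indepU1 (indep2 nyz) _.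
by move=> t /set2P[]->.
Qed.

Definition proper_on (T : eqType) S (f : G -> T) :=
  {in S &, forall x y, adj x y -> f x != f y}.

Definition proper_onb S (f : {ffun G -> G}) :=
  [forall x in S, forall y in S, adj x y ==> (f x != f y)].

Lemma proper_onP S (f : {ffun G -> G}) :
  reflect (proper_on S f) (proper_onb S f).
Proof.
apply: (iffP forall_inP) => [h x y xS yS xy|h x xS].
  by move/forall_inP: (h x xS) => /(_ y yS)/implyP; apply.
by apply/forall_inP=> y yS; apply/implyP; apply: h.
Qed.

(* Vertices serve as colours, so that a best colouring can be picked from a
   finite type. *)
Definition chi_set S : nat :=
  #|[arg min_(f < [ffun x : G => x] | proper_onb S f) #|f @: S| ] @: S|.

Lemma chi_set_ex S :
  exists2 f : {ffun G -> G}, proper_on S f & #|f @: S| = chi_set S.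
Proof.
rewrite /chi_set; case: arg_minnP => [|f /proper_onP pf _]; last by exists f.
apply/proper_onP=> x y _ _ xy; rewrite !ffunE.
by apply: contraTneq xy => ->; rewrite adj_irr.
Qed.

(** Colours from any finite type [T] are replaced by vertices: [g] sends [x] to a chosen vertex of
    [S] that has the colour of [x]. *)
Lemma chi_set_le (T : finType) S (f : G -> T) :
  proper_on S f -> chi_set S <= #|f @: S|.
Proof.
move=> pf.
pose g := [ffun x : G => odflt x [pick z in S | f z == f x]].
have gP x : x \in S -> (g x \in S) && (f (g x) == f x).
  move=> xS; rewrite ffunE; case: pickP => [z //|/(_ x)].
  by rewrite /= xS eqxx.
have pg : proper_onb S g.
  apply/proper_onP=> x y xS yS xy; apply: contra (pf _ _ xS yS xy) => /eqP gxy.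
  by case/andP: (gP x xS) => _ /eqP<-; case/andP: (gP y yS) => _ /eqP<-; rewrite gxy.
apply: leq_trans (_ : #|g @: S| <= _).
  rewrite /chi_set; case: arg_minnP => [|h _]; last exact.
  apply/proper_onP=> x y _ _ xy; rewrite !ffunE.
  by apply: contraTneq xy => ->; rewrite adj_irr.
rewrite -(@card_in_imset _ _ f (g @: S)); last first.
  move=> _ _ /imsetP[x xS ->] /imsetP[y yS ->].
  case/andP: (gP x xS) => _ /eqP-> ; case/andP: (gP y yS) => _ /eqP-> fxy.
  rewrite !ffunE.
  have -> : [pick z in S | f z == f x] = [pick z in S | f z == f y].
    by apply: eq_pick => z /=; rewrite fxy.
  by case: pickP => //= /(_ y); rewrite /= yS eqxx.
apply/subset_leq_card/subsetP=> _ /imsetP[_ /imsetP[x xS ->] ->].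
case/andP: (gP x xS) => gS _; apply/imsetP; exists x => //.
by case/andP: (gP x xS) => _ /eqP.
Qed.

Lemma chi_set_sub A B : A \subset B -> chi_set A <= chi_set B.
Proof.
move=> sAB; have [f pf <-] := chi_set_ex B.
apply: leq_trans (subset_leq_card (imsetS f sAB)); apply: chi_set_le.
by move=> x y xA yA; apply: pf; apply: (subsetP sAB).
Qed.

Lemma chi_set0 : chi_set set0 = 0.
Proof. by have [f _ <-] := chi_set_ex set0; rewrite imset0 cards0. Qed.

Lemma chi_set1 x : 0 < chi_set [set x].
Proof.
have [f _ <-] := chi_set_ex [set x].
by rewrite card_gt0; apply/set0Pn; exists (f x); rewrite imset_f ?set11.
Qed.

(** The two colourings are glued with disjoint palettes; vertices in both sets follow the first. *)
Lemma chi_setU A B : chi_set (A :|: B) <= chi_set A + chi_set B.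
Proof.
have [f pf <-] := chi_set_ex A; have [g pg <-] := chi_set_ex B.
pose h x := if x \in A then inl (f x) else inr (g x) : (G + G)%type.
apply: leq_trans (chi_set_le (f := h) _) _.
  move=> x y; rewrite !inE /h.
  case: ifP => xA; case: ifP => yA //= xB yB xy.
    by apply: contra (pf _ _ xA yA xy) => /eqP[->].
  by apply: contra (pg _ _ xB yB xy) => /eqP[->].
apply: leq_trans (_ : #|inl @: (f @: A) :|: inr @: (g @: B)| <= _); last first.
  by apply: leq_trans (leq_card_setU _ _) _; apply: leq_add; apply: leq_imset_card.
apply: subset_leq_card.
apply/subsetP=> _ /imsetP[x xAB ->]; rewrite /h inE.
case: ifP xAB => [xA _|xA]; first by rewrite !imset_f.
by rewrite inE xA /= => xB; rewrite orbC !imset_f.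
Qed.

Lemma chi_set_indep A : indep A -> chi_set A <= 1.
Proof.
move=> /indepP iA; apply: leq_trans (chi_set_le (f := fun=> tt) _) _.
  by move=> x y xA yA; rewrite (negPf (iA _ _ xA yA)).
by apply: leq_trans (max_card _) _; rewrite card_unit.
Qed.

Lemma chi_set_indepU A B : indep A -> chi_set (A :|: B) <= (chi_set B).+1.
Proof.
by move=> iA; apply: leq_trans (chi_setU _ _) _; rewrite -add1n leq_add2r chi_set_indep.
Qed.

Lemma chi_set_join A B : {in A & B, forall x y, adj x y} ->
  chi_set A + chi_set B <= chi_set (A :|: B).
Proof.
move=> AB; have [f pf <-] := chi_set_ex (A :|: B).
rewrite imsetU cardsU disjoint_setI0 ?cards0 ?subn0; last first.
  apply/pred0P=> c /=; apply/negP=> /andP[/imsetP[x xA ->] /imsetP[y yB /eqP]].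
  by apply/negP; apply: pf; rewrite ?inE ?xA ?yB ?orbT //; apply: AB.
by apply: leq_add; apply: chi_set_le => x y xA yA; apply: pf; rewrite !inE ?xA ?yA ?orbT.
Qed.

(** Independence number at most 2: colour classes in [S] then have at most two vertices. *)
Definition no3 S := forall x y z, x \in S -> y \in S -> z \in S ->
  x != y -> x != z -> y != z ->
  ~~ adj x y -> ~~ adj x z -> ~~ adj y z -> False.

Lemma no3S A B : A \subset B -> no3 B -> no3 A.
Proof. by move=> /subsetP s nB x y z /s xB /s yB /s; apply: nB. Qed.

Lemma no3_fibre (T : finType) S (f : G -> T) (c : T) : no3 S -> proper_on S f ->
  #|[set x in S | f x == c]| <= 2.
Proof.
move=> n3 pf; rewrite leqNgt; apply/negP.
case/card_gt2P=> x [y [z []]]; rewrite !inE.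
case=> /andP[xS /eqP fx] /andP[yS /eqP fy] /andP[zS /eqP fz] [xy yz zx].
have nadj u v : u \in S -> v \in S -> f u = f v -> ~~ adj u v.
  by move=> uS vS /eqP fuv; apply: contraL fuv; apply: pf.
apply: (n3 x y z) => //; rewrite 1?eq_sym //; apply: nadj => //; congruence.
Qed.

Lemma chi_set_half S : no3 S -> #|S| <= 2 * chi_set S.
Proof.
move=> n3; have [f pf <-] := chi_set_ex S.
rewrite -sum1_card (partition_big_imset f) /= mulnC -sum_nat_const.
apply: leq_sum => c _; rewrite sum1dep_card; exact: no3_fibre.
Qed.

End Colouring.

(** * Connected sets and dominating models inside a vertex set *)

Section Minors.
Variable G : sgraph.
Implicit Types (S A B X T U : {set G}) (x y z : G).

Definition sadj T : rel G := fun x y => [&& x \in T, y \in T & adj x y].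

(** Rooted at a vertex [c], so that a connected set is nonempty by definition. *)
Definition conn T := exists2 c, c \in T & {in T, forall x, connect (sadj T) c x}.

Definition dom T X := forall x, x \in X -> exists2 y, y \in T & adj x y.

(* [dm U t]: U contains a dominating model with t parts; the first part is T. *)
Inductive dm : {set G} -> nat -> Prop :=
| dm0 U : dm U 0
| dmS U T X t : dm X t -> conn T -> dom T X -> [disjoint T & X] ->
    T \subset U -> X \subset U -> dm U t.+1.

Lemma dm_sub U U' t : U \subset U' -> dm U t -> dm U' t.
Proof.
move=> sUU' d; case: d sUU' => [V|V T X s d c h dj sT sX] s'; first exact: dm0.
by apply: dmS d c h dj _ _; apply: subset_trans s'.
Qed.

Lemma dm_leq U t t' : dm U t -> t' <= t -> dm U t'.
Proof.
move=> d; elim: d t' => [V|V T X s d IH c h dj sT sX] [|t'] // le; try exact: dm0.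
by apply: dmS (IH _ le) c h dj sT sX.
Qed.

Lemma sadjC T : symmetric (sadj T).
Proof. by move=> x y; rewrite /sadj andbCA adjC. Qed.

Lemma conn1 x : conn [set x].
Proof. by exists x; rewrite ?set11 // => y /set1P->; apply: connect0. Qed.

Lemma conn_star c A : {in A, forall x, adj c x} -> conn (c |: A).
Proof.
move=> cA; exists c; rewrite ?setU11 // => x /setU1P[->|xA]; first exact: connect0.
by apply: connect1; rewrite /sadj setU11 inE xA orbT cA.
Qed.

Lemma conn2 x y : adj x y -> conn [set x; y].
Proof. by move=> xy; apply: conn_star => z /set1P->. Qed.

Lemma conn_add x y T : conn T -> y \in T -> adj x y -> conn (x |: T).
Proof.
move=> [c cT cP] yT xy; exists c; first by rewrite inE cT orbT.
have sub : subrel (sadj T) (sadj (x |: T)).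
  by move=> u v /and3P[uT vT uv]; rewrite /sadj !inE uT vT uv !orbT.
have cc z : z \in T -> connect (sadj (x |: T)) c z.
  by move=> zT; apply: connect_sub (cP _ zT) => u v uv; apply/connect1/sub.
move=> z /setU1P[->|/cc //]; apply: connect_trans (cc _ yT) _.
by apply: connect1; rewrite /sadj !inE eqxx yT orbT adjC xy.
Qed.

Definition full_sub T : presubgraph G :=
  (T, [set A | [exists x in T, exists y in T, adj x y && (A == [set x; y])]]).

Lemma full_sub_ok T : conn T ->
  [&& is_subgraph (full_sub T), verts (full_sub T) != set0
    & sub_connected (full_sub T)].
Proof.
case=> c cT cP; apply/and3P; split.
- by apply/forall_inP=> A; rewrite inE.
- by apply/set0Pn; exists c.
have sub x y : sadj T x y -> sub_adj (full_sub T) x y.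
  case/and3P=> xT yT xy; rewrite /sub_adj inE; apply/existsP; exists x.
  by rewrite xT /=; apply/existsP; exists y; rewrite yT xy eqxx.
apply/forall_inP=> x xT; apply/forall_inP=> y yT.
apply: (@connect_sub _ (sadj T)) => [u v uv|]; first exact/connect1/sub.
apply: connect_trans (cP _ yT).
by rewrite (sym_connect_sym (sadjC T)) cP.
Qed.

(** Indexing by [nat] lets the recursion shift indices; values from [t] on are arbitrary. *)
Lemma dm_family U t : dm U t -> exists T : nat -> presubgraph G,
  forall i, i < t -> [/\ [&& is_subgraph (T i), verts (T i) != set0
      & sub_connected (T i)], verts (T i) \subset U
    & forall j, i < j < t -> [disjoint verts (T i) & verts (T j)] /\
        dom (verts (T i)) (verts (T j))].
Proof.
elim=> {U t} [U|U T X t _ [F IH] cT dT dj sT sX].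
  by exists (fun=> full_sub set0).
exists (fun i => if i is j.+1 then F j else full_sub T) => -[|i] lt.
  split=> // [|[|j] // lj]; first exact: full_sub_ok.
  have [_ sj _] := IH j lj; split.
    by apply: disjointWr sj dj.
  by move=> y yj; apply: dT; apply: (subsetP sj).
have [ok sub rel] := IH i lt; split=> // [|[|j] //]; last exact: rel.
exact: subset_trans sub sX.
Qed.

Lemma dm_dominating_minor t : dm [set: G] t -> dominating_minor G t.
Proof.
move=> /dm_family[F FP]; apply/existsP; exists [ffun i : 'I_t => F i].
apply/and3P; split.
- by apply/forallP=> i; rewrite ffunE; have [] := FP i (ltn_ord i).
- apply/forallP=> i; apply/forallP=> j; apply/implyP=> nij; rewrite !ffunE.
  have [lij|lji|/val_inj eij] := ltngtP i j.
  + by have [_ _ /(_ j)] := FP i (ltn_ord i); rewrite lij ltn_ord => /(_ isT)[].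
  + rewrite disjoint_sym.
    by have [_ _ /(_ i)] := FP j (ltn_ord j); rewrite lji ltn_ord => /(_ isT)[].
  + by rewrite eij eqxx in nij.
- apply/forallP=> i; apply/forallP=> j; apply/implyP=> lij; rewrite !ffunE.
  apply/forall_inP=> y yj; have [_ _ /(_ j)] := FP i (ltn_ord i).
  rewrite lij ltn_ord => /(_ isT)[_ /(_ y yj)[x xi xy]].
  by apply/existsP; exists x; rewrite xi.
Qed.

(** The vertices used as colours are numbered by their rank in the image. This ranking takes a
    default vertex, so the empty graph is treated apart. *)
Lemma chi_le_chi_set : chi G <= chi_set [set: G].
Proof.
have [f pf <-] := chi_set_ex [set: G]; rewrite /chi; case: ex_minnP => m _; apply.
have fP x : f x \in f @: [set: G] by rewrite imset_f.
apply/existsP.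
case: (pickP (mem [set: G])) => [x0 _|no]; last first.
  exists [ffun x => False_rect _ (notF (etrans (esym (no x)) (in_setT x)))].
  by apply/forallP=> x; case: (notF (etrans (esym (no x)) (in_setT x))).
exists [ffun x => enum_rank_in (fP x0) (f x)].
apply/forallP=> x; apply/forallP=> y; apply/implyP=> xy; rewrite !ffunE.
apply: contra (pf x y (in_setT x) (in_setT y) xy) => /eqP e.
by rewrite -(enum_rankK_in (fP x0) (fP x)) e enum_rankK_in.
Qed.

Lemma free_twoK2 (a b c d : G) : free twoK2 G -> adj a b -> adj c d ->
  ~~ adj a c -> ~~ adj a d -> ~~ adj b c -> ~~ adj b d -> False.
Proof.
move=> /(_ [set a; b; c; d]) noiso ab cd ac ad bc bd; apply: noiso.
have neq x y z : adj x y -> ~~ adj x z -> y != z.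
  by move=> xy; apply: contraNneq => <-.
have n_ab : a != b by apply: contraTneq ab => ->; rewrite adj_irr.
have n_cd : c != d by apply: contraTneq cd => ->; rewrite adj_irr.
have n_bc := neq _ _ _ ab ac; have n_bd := neq _ _ _ ab ad.
have ba : adj b a by rewrite adjC.
have n_ac := neq _ _ _ ba bc; have n_ad := neq _ _ _ ba bd.
(* The first coordinate separates {a, b} from {c, d}, the second {a, c} from {b, d}. *)
pose f (u : induced [set a; b; c; d]) : twoK2 :=
  ((val u == a) || (val u == b), (val u == a) || (val u == c)).
pose g0 (p : bool * bool) :=
  if p.1 then (if p.2 then a else b) else (if p.2 then c else d).
have gS p : g0 p \in [set a; b; c; d].
  by case: p => -[] [] /=; rewrite !inE /= eqxx ?orbT.
exists f; split.
  exists (fun p => exist (fun x => x \in [set a; b; c; d]) (g0 p) (gS p) : induced _).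
    move=> [x xS]; apply: val_inj => /=; rewrite /f /=.
    move: xS; rewrite !inE -!orbA => /or4P[] /eqP->.
    - by rewrite eqxx.
    - by rewrite eqxx orbT eq_sym (negPf n_ab) (negPf n_bc).
    - by rewrite ![c == _]eq_sym (negPf n_ac) (negPf n_bc) eqxx orbT.
    - by rewrite ![d == _]eq_sym (negPf n_ad) (negPf n_bd) (negPf n_cd).
  move=> [[] []]; rewrite /f /=.
  - by rewrite eqxx.
  - by rewrite eqxx orbT eq_sym (negPf n_ab) (negPf n_bc).
  - by rewrite ![c == _]eq_sym (negPf n_ac) (negPf n_bc) eqxx orbT.
  - by rewrite ![d == _]eq_sym (negPf n_ad) (negPf n_bd) (negPf n_cd).
have [ca da cb db] : [/\ ~~ adj c a, ~~ adj d a, ~~ adj c b & ~~ adj d b].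
  by rewrite ![adj c _]adjC ![adj d _]adjC.
have dc : adj d c by rewrite adjC.
move=> [x xS] [y yS]; rewrite /f /= /induced_adj /=.
move: xS yS; rewrite !inE -!orbA => /or4P[] /eqP-> /or4P[] /eqP->;
  rewrite /twoK2_adj /= ?eqxx ?orbT ?adj_irr ?ab ?cd ?ba ?dc
    ?(negPf ac) ?(negPf ad) ?(negPf bc) ?(negPf bd)
    ?(negPf ca) ?(negPf da) ?(negPf cb) ?(negPf db)
    ?(negPf n_ab) ?(negPf n_cd) ?(negPf n_ac) ?(negPf n_ad) ?(negPf n_bc) ?(negPf n_bd)
    1?[b == a]eq_sym 1?[c == a]eq_sym 1?[c == b]eq_sym 1?[d == a]eq_sym
    1?[d == b]eq_sym 1?[d == c]eq_sym
    ?(negPf n_ab) ?(negPf n_cd) ?(negPf n_ac) ?(negPf n_ad) ?(negPf n_bc) ?(negPf n_bd) //.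
Qed.

End Minors.


(** * Orbits of the product of two involutions *)

Section TwoInvolutions.
Variables (T : finType) (m1 m2 : T -> T) (t : T).
Hypotheses (m1K : involutive m1) (m2K : involutive m2) (m2t : m2 t = t).
Let s x := m2 (m1 x).

Lemma comp_inv_inj : injective s.
Proof. by move=> x y /(inv_inj m2K)/(inv_inj m1K). Qed.

(** [m2] conjugates [s] to its inverse and fixes [t], so it maps the point n steps after [t] to the
    point n steps before it. *)
Lemma iter_refl n : iter n s (m2 (iter n s t)) = t.
Proof.
elim: n => [|n IH] //=; rewrite -iterS iterSr -[in RHS]IH; congr iter.
by rewrite /s m2K m1K.
Qed.

Lemma orbit_closed2 x : fconnect s t x -> fconnect s t (m2 x).
Proof.
move/iter_findex=> <-; rewrite (fconnect_sym comp_inv_inj).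
by rewrite -{3}(iter_refl (findex s t x)) fconnect_iter.
Qed.

Lemma orbit_closed1 x : fconnect s t x -> fconnect s t (m1 x).
Proof.
move=> tx; rewrite (same_fconnect1_r comp_inv_inj) /s m1K; exact: orbit_closed2.
Qed.

(* m2 reverses the orbit of t about t, so a fixed point of m1 lies exactly
   opposite to t; in particular it is unique. *)
Lemma orbit_fix_order x : fconnect s t x -> m1 x = x ->
  (findex s t x).*2.+1 = order s t.
Proof.
move=> tx fx; set n := findex s t x.
have e : iter (n + n.+1) s t = t.
  have ex : iter n s t = x by apply: iter_findex.
  have sx : s x = m2 x by rewrite /s fx.
  by rewrite iterD iterS ex sx -ex iter_refl.
have ltn : n < order s t by rewrite findex_max.
(* The iterate of exponent 2n + 1 fixes [t], and 2n + 1 lies strictly between 0 and twice the order;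
   so it is the order. *)
have [lt|ge] := ltnP (n + n.+1) (order s t).
  by have := findex_iter lt; rewrite e findex0; lia.
have e' : iter (n + n.+1 - order s t) s t = t.
  by have := e; rewrite -{1}(subnK ge) iterD (iter_order comp_inv_inj).
have lt' : n + n.+1 - order s t < order s t by lia.
by have := findex_iter lt'; rewrite e' findex0; lia.
Qed.

Lemma orbit_fix_uniq x y : fconnect s t x -> fconnect s t y ->
  m1 x = x -> m1 y = y -> x = y.
Proof.
move=> tx ty fx fy; rewrite -(iter_findex tx) -(iter_findex ty); congr iter.
by have := orbit_fix_order tx fx; rewrite -(orbit_fix_order ty fy); lia.
Qed.

End TwoInvolutions.

(** * Gallai's lemma, for matchings of the complement *)

Section Gallai.
Variable G : sgraph.
Implicit Types (S C : {set G}) (x y z u v : G) (m : G -> G).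

(* The pairs {x, m x} are edges of the complement of G. *)
Definition comatching S m :=
  involutive m /\ forall x, m x != x -> (x \in S) && ~~ adj x (m x).

(* Twice the number of classes of the colouring into the sets {x, m x}. *)
Definition weight S m := \sum_(x in S) (m x == x).+1.

Lemma comatching_mem S m x : comatching S m -> x \in S -> m x \in S.
Proof.
case=> mK mP xS; have [-> //|nx] := eqVneq (m x) x.
have /mP/andP[] // : m (m x) != m x by rewrite mK eq_sym.
Qed.

(** Colouring [x] by the set {x, m x} is proper; a pair contributes 1 + 1 to the weight and a fixed
    point 2. *)
Lemma chi_set_comatching S m : comatching S m -> 2 * chi_set S <= weight S m.
Proof.
move=> mm; have [mK mP] := mm.
pose f x := [set x; m x].
have pf : proper_on S f.
  move=> x y xS yS xy; apply/eqP=> fxy.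
  have nxy : y != x by apply: contraTneq xy => ->; rewrite adj_irr.
  have : y \in f x by rewrite fxy set21.
  rewrite !inE (negPf nxy) /= => /eqP ey; move: xy; rewrite ey.
  by have /mP/andP[_ /negPf->] : m x != x by rewrite -ey.
apply: leq_trans (_ : 2 * #|f @: S| <= _); first by rewrite leq_mul2l chi_set_le.
rewrite /weight (partition_big_imset f) /= mulnC -sum_nat_const.
apply: leq_sum => _ /imsetP[x xS ->].
rewrite (bigD1 x) /=; last by rewrite xS eqxx.
have [e|ne] := eqVneq (m x) x; first by lia.
rewrite (bigD1 (m x)) /=; first by lia.
rewrite (comatching_mem mm xS) ne /f mK andbT.
by apply/eqP/setP=> z; rewrite !inE orbC.
Qed.

(** [m] swaps the vertices of each two-element class of a best colouring and fixes everything
    else. *)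
Lemma comatching_exists S : no3 S ->
  exists2 m, comatching S m & weight S m <= 2 * chi_set S.
Proof.
move=> n3; have [f pf <-] := chi_set_ex S.
pose m x := if x \in S then odflt x [pick y in S | (y != x) && (f y == f x)] else x.
have uniq3 x y z : x \in S -> y \in S -> z \in S -> f y = f x -> f z = f x ->
    y != x -> z != x -> y = z.
  move=> xS yS zS fy fz yx zx; apply/eqP; apply: contraT => yz.
  have := no3_fibre (f x) n3 pf; rewrite leqNgt => /negP[].
  by apply/card_gt2P; exists x, y, z; rewrite !inE xS yS zS fy fz !eqxx yz zx eq_sym yx.
have mE x y : x \in S -> y \in S -> y != x -> f y = f x -> m x = y.
  move=> xS yS yx fy; rewrite /m xS; case: pickP => [z /and3P[zS zx /eqP fz]|/(_ y)] /=.
    exact: (uniq3 x).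
  by rewrite yS yx fy eqxx.
have mP x : m x != x -> [/\ x \in S, m x \in S & f (m x) = f x].
  rewrite {1}/m; case: ifP => xS; last by rewrite eqxx.
  case: pickP => [z /and3P[zS zx /eqP fz] _|_]; last by rewrite eqxx.
  by rewrite (mE x z).
have mK : involutive m.
  move=> x; have [mx|nx] := eqVneq (m x) x; first by rewrite !mx.
  have [xS yS fy] := mP x nx.
  by apply: mE; rewrite // eq_sym.
exists m.
  split=> // x nx; have [xS yS fy] := mP x nx; rewrite xS /=.
  by apply/negP=> /(pf x (m x) xS yS); rewrite fy eqxx.
rewrite /weight (partition_big_imset f) /= mulnC -sum_nat_const.
apply: leq_sum => c _.
(* A class with a fixed point is a singleton, of weight 2; any other class has at most two vertices,
   of weight 1 each. *)
case: (pickP [pred x in S | (f x == c) && (m x == x)]) => [x /and3P[xS fx mx]|no].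
  rewrite (bigD1 x) /=; last by rewrite xS fx.
  rewrite big1 ?mx // => y /andP[/andP[yS fy] yx].
  by have := mE x y xS yS yx; rewrite (eqP fx) (eqP fy) (eqP mx) => /(_ erefl) e; rewrite e eqxx in yx.
have -> : \sum_(x in S | f x == c) (m x == x).+1 = \sum_(x in S | f x == c) 1.
  apply: eq_bigr => x /andP[xS fx]; have := no x; rewrite /= xS fx /= => ->.
  by [].
rewrite sum1dep_card; exact: no3_fibre.
Qed.

Definition coadj S : rel G := fun x y => [&& x \in S, y \in S, x != y & ~~ adj x y].

(** Hence if [m1] and [m2] have least weight and both mixtures are comatchings, the mixtures have
    least weight too. *)
Lemma weight_mix C m1 m2 (P : pred G) :
  weight C (fun x => if P x then m2 x else m1 x) +
  weight C (fun x => if P x then m1 x else m2 x) = weight C m1 + weight C m2.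
Proof.
rewrite /weight -!big_split /=; apply: eq_bigr => x _.
by case: (P x); rewrite // addnC.
Qed.

Lemma comatching_mix C m1 m2 (P : pred G) :
  comatching C m1 -> comatching C m2 ->
  (forall x, P x -> P (m1 x)) -> (forall x, P x -> P (m2 x)) ->
  comatching C (fun x => if P x then m2 x else m1 x).
Proof.
move=> [K1 M1] [K2 M2] P1 P2; split=> x.
  have [Px|nPx] := boolP (P x); first by rewrite P2 // K2.
  rewrite ifN ?K1 //; apply: contra nPx => /P1; by rewrite K1.
by case: (P x) => [/M2|/M1].
Qed.

Section Critical.
Variable C : {set G}.
Hypotheses (C3 : no3 C) (Ccrit : {in C, forall y, chi_set (C :\ y) < chi_set C}).

(** The converse inequality is [chi_set_comatching]. *)
Definition optimal m := comatching C m /\ weight C m <= 2 * chi_set C.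

(** By criticality, a best colouring of [C :\ y] extends to one of [C] in which [y] is a class of
    its own. *)
Lemma optimal_missing y : y \in C -> exists2 m, optimal m & m y = y.
Proof.
move=> yC; have n3 : no3 (C :\ y) by apply: no3S C3; apply: subsetDl.
have [m [mK mP] wm] := comatching_exists n3.
have my : m y = y.
  apply/eqP; apply: contraT => /mP; by rewrite !inE eqxx.
exists m => //; split.
  by split=> // x /mP/andP[/setD1P[_ ->]].
rewrite /weight (big_setD1 y) //= my eqxx.
have := Ccrit yC; move: wm; rewrite /weight; lia.
Qed.

Definition comissed u v := exists m, [/\ optimal m, m u = u & m v = v].

(** Joining [u] and [v] into one class would lower the weight by 2, below twice the chromatic
    number. *)
Lemma comissed_coadj u v : coadj C u v -> ~ comissed u v.
Proof.
case/and4P=> uC vC nuv nadj [m [[[mK mP] wm] mu mv]].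
pose m' x := if x == u then v else if x == v then u else m x.
have m'u : m' u = v by rewrite /m' eqxx.
have m'v : m' v = u by rewrite /m' eq_sym (negPf nuv) eqxx.
have m'E x : x != u -> x != v -> m' x = m x by rewrite /m' => /negPf-> /negPf->.
have mm' : comatching C m'.
  split=> x.
    have [->|xu] := eqVneq x u; first by rewrite m'u m'v.
    have [->|xv] := eqVneq x v; first by rewrite m'v m'u.
    have mxu : m x != u by rewrite -[X in _ != X]mu (inj_eq (inv_inj mK)).
    have mxv : m x != v by rewrite -[X in _ != X]mv (inj_eq (inv_inj mK)).
    by rewrite (m'E x) // m'E // mK.
  have [->|xu] := eqVneq x u; first by rewrite m'u uC.
  have [->|xv] := eqVneq x v; first by rewrite m'v vC adjC.
  by rewrite m'E //; apply: mP.
have := chi_set_comatching mm'; move: wm; rewrite /weight.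
rewrite !(big_setD1 u uC) /= mu m'u eqxx eq_sym (negPf nuv).
have vC' : v \in C :\ u by rewrite !inE eq_sym nuv vC.
rewrite !(big_setD1 v vC') /= mv m'v eqxx (negPf nuv).
have -> : \sum_(x in C :\ u :\ v) (m' x == x).+1 = \sum_(x in C :\ u :\ v) (m x == x).+1.
  by apply: eq_bigr => x; rewrite !inE => /and3P[xv xu _]; rewrite m'E.
lia.
Qed.

(* Exchanging m1 and m2 on the alternating path from t keeps both optimal, and
   this path contains at most one of u and v. *)
Lemma comissed_trans t u v : u != v -> t \in C ->
  comissed u v -> comissed u t \/ comissed t v.
Proof.
move=> nuv tC [m1 [[M1 w1] m1u m1v]].
have [m2 [M2 w2] m2t] := optimal_missing tC.
have [K1 _] := M1; have [K2 _] := M2.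
pose P x := fconnect (fun x => m2 (m1 x)) t x.
have P1 x : P x -> P (m1 x) by apply: orbit_closed1.
have P2 x : P x -> P (m2 x) by apply: orbit_closed2.
pose m x := if P x then m2 x else m1 x.
have Mm : comatching C m by apply: comatching_mix.
have opt : optimal m.
  split=> //.
  have := chi_set_comatching (comatching_mix M2 M1 P2 P1).
  have := weight_mix C m1 m2 P; rewrite -/m; lia.
have mt : m t = t by rewrite /m /P connect0.
have [Pu|nPu] := boolP (P u); last first.
  by left; exists m; split=> //; rewrite /m (negPf nPu).
have [Pv|nPv] := boolP (P v); last first.
  by right; exists m; split=> //; rewrite /m (negPf nPv).
by case/eqP: nuv; apply: (orbit_fix_uniq K1 K2 m2t Pu Pv).
Qed.

(** Connectivity of the complement spreads [comissed_coadj] along paths, so an optimal matching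
    fixes at most one vertex of [C]. *)
Lemma gallai : {in C &, forall x y, connect (coadj C) x y} ->
  2 * chi_set C <= #|C|.+1.
Proof.
move=> conn.
have [->|[y yC]] := set_0Vmem C; first by rewrite chi_set0.
have no u v : u \in C -> v \in C -> u != v -> ~ comissed u v.
  move=> uC vC; have /connectP[p] := conn u v uC vC.
  (* If [u] and [w] are missed together, then by [comissed_trans] the vertex before [w] on the path
     is missed together with [u] or with [w]. *)
  elim/last_ind: p v vC => [|p w IH] v vC /=; first by move=> _ ->; rewrite eqxx.
  rewrite rcons_path last_rcons => /andP[up pw] -> nuw d.
  have /and4P[zC _ _ _] := pw.
  have [e|nuz] := eqVneq u (last u p).
    by apply: comissed_coadj d; rewrite [in X in coadj _ X]e.
  have [d'|d'] := comissed_trans nuw zC d; last exact: comissed_coadj d'.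
  exact: IH zC up erefl nuz d'.
have [m [Mm wm] my] := optimal_missing yC.
apply: leq_trans (chi_set_comatching Mm) _.
rewrite /weight (big_setD1 y) //= my eqxx (cardsD1 y) yC.
rewrite (eq_bigr (fun=> 1)) ?sum1_card // => x /setD1P[xy xC].
case: eqP => // mx; case: (no x y xC yC xy); by exists m.
Qed.

End Critical.
End Gallai.


(** * A least vertex set without a model *)

Section Minimal.
Variables (G : sgraph) (U : {set G}).
Hypothesis G2 : free twoK2 G.
Hypothesis IHU : forall X : {set G}, X \proper U -> dm X (chi_set X).
Hypothesis noU : ~ dm U (chi_set U).
Implicit Types (I A B J Q R S T X Y Z : {set G}) (a b c d e i j x y z : G).

Let k := chi_set U.

Lemma twoK2F a b c d : adj a b -> adj c d ->
  ~~ adj a c -> ~~ adj a d -> ~~ adj b c -> ~~ adj b d -> False.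
Proof. exact: free_twoK2. Qed.

Lemma disjI A B : (forall x, x \in A -> x \in B -> False) -> [disjoint A & B].
Proof. by move=> h; apply/pred0P=> x /=; apply/negP=> /andP[xA xB]; apply: (h x). Qed.

Lemma domU T A B : dom T A -> dom T B -> dom T (A :|: B).
Proof. by move=> hA hB x /setUP[/hA|/hB]. Qed.

Lemma dm_small t X : dm X t -> X \subset U -> k <= t -> False.
Proof. by move=> d sX le; apply: noU; apply: dm_leq le; apply: dm_sub d. Qed.

Lemma dm_add T X t : dm X t -> conn T -> dom T X -> [disjoint T & X] ->
  dm (T :|: X) t.+1.
Proof. by move=> d cT dT dj; apply: dmS d cT dT dj _ _; rewrite ?subsetUl ?subsetUr. Qed.

Lemma disj_rest R T : T \subset R -> [disjoint T & U :\: R].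
Proof. by move=> /subsetP s; apply: disjI => x /s xR; rewrite inE xR. Qed.

(** [T] certifies that [R] is nonempty, so that [U :\: R] is smaller than [U]. *)
Lemma IHrest R T : R \subset U -> T \subset R -> conn T ->
  dm (U :\: R) (chi_set (U :\: R)).
Proof.
move=> sR sT [c cT _]; apply: IHU; rewrite properE subsetDl /=.
apply/subsetPn; exists c; first by rewrite (subsetP sR) ?(subsetP sT).
by rewrite inE (subsetP sT).
Qed.

(** The part [T] is put in front of the model that [U :\: R] has by minimality; [fail2] and [fail3]
    put two or three parts in front. *)
Lemma fail1 R T : R \subset U -> T \subset R -> conn T -> dom T (U :\: R) ->
  k <= chi_set (U :\: R) + 1 -> False.
Proof.
move=> sR sT cT dT; rewrite addn1; apply: dm_small (dm_add (IHrest sR sT cT) cT dT _) _.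
  exact: disj_rest.
by rewrite subUset (subset_trans sT) ?subsetDl.
Qed.

Lemma fail2 R S T : R \subset U -> S \subset R -> T \subset R ->
  conn S -> conn T -> [disjoint S & T] -> dom S T ->
  dom S (U :\: R) -> dom T (U :\: R) -> k <= chi_set (U :\: R) + 2 -> False.
Proof.
move=> sR sS sT cS cT dj dST dS dT; rewrite addn2.
have d1 := dm_add (IHrest sR sT cT) cT dT (disj_rest sT).
have dj' : [disjoint S & T :|: U :\: R].
  apply: disjI => x xS /setUP[xT|]; first by rewrite (disjointFr dj xS) in xT.
  by rewrite inE (subsetP sS _ xS).
apply: dm_small (dm_add d1 cS (domU dST dS) dj') _.
by rewrite !subUset subsetDl !(subset_trans _ sR).
Qed.

Lemma fail3 R Q S T : R \subset U -> Q \subset R -> S \subset R -> T \subset R ->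
  conn Q -> conn S -> conn T ->
  [disjoint Q & S] -> [disjoint Q & T] -> [disjoint S & T] ->
  dom Q S -> dom Q T -> dom S T ->
  dom Q (U :\: R) -> dom S (U :\: R) -> dom T (U :\: R) ->
  k <= chi_set (U :\: R) + 3 -> False.
Proof.
move=> sR sQ sS sT cQ cS cT djQS djQT djST dQS dQT dST dQ dS dT; rewrite addn3.
have d1 := dm_add (IHrest sR sT cT) cT dT (disj_rest sT).
have dj' : [disjoint S & T :|: U :\: R].
  apply: disjI => x xS /setUP[xT|]; first by rewrite (disjointFr djST xS) in xT.
  by rewrite inE (subsetP sS _ xS).
have d2 := dm_add d1 cS (domU dST dS) dj'.
have dj'' : [disjoint Q & S :|: (T :|: U :\: R)].
  apply: disjI => x xQ /setUP[xS|/setUP[xT|]].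
  - by rewrite (disjointFr djQS xQ) in xS.
  - by rewrite (disjointFr djQT xQ) in xT.
  - by rewrite inE (subsetP sQ _ xQ).
apply: dm_small (dm_add d2 cQ (domU dQS (domU dQT dQ)) dj'') _.
by rewrite !subUset subsetDl !(subset_trans _ sR).
Qed.

Lemma chi_cover R : R \subset U -> k <= chi_set (U :\: R) + chi_set R.
Proof.
move=> sR; apply: leq_trans (chi_setU _ _); apply: chi_set_sub.
by apply/subsetP=> x xU; rewrite !inE xU andbT orNb.
Qed.

(** * Maximum independent sets and neighbourhoods in them *)

Definition maxindep I :=
  [/\ I \subset U, indep I & forall J, J \subset U -> indep J -> #|J| <= #|I| ].

Definition nbr I b := [set j in I | adj b j].

Lemma nbrP I b j : (j \in nbr I b) = (j \in I) && adj b j.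
Proof. by rewrite inE. Qed.

Lemma nbr_sub I b : nbr I b \subset I.
Proof. by apply/subsetP=> j; rewrite nbrP => /andP[]. Qed.

Lemma nbr_conn I b S : S \subset nbr I b -> conn (b |: S).
Proof. by move=> /subsetP s; apply: conn_star => x /s; rewrite nbrP => /andP[]. Qed.

(** With private neighbours [j] of [b] and [i] of [c], the edges b j and c i would form an induced
    2K2. *)
Lemma nested I b c : indep I -> ~~ adj b c ->
  nbr I b \subset nbr I c \/ nbr I c \subset nbr I b.
Proof.
move=> /indepP iI nbc; apply/orP; apply: contraT; rewrite negb_or.
case/andP=> /subsetPn[j jb njc] /subsetPn[i ic nib].
move: jb njc ic nib; rewrite !nbrP => /andP[jI bj] + /andP[iI' ci].
rewrite jI iI' /= => ncj nbi.
case: (@twoK2F b j c i) => //; first by rewrite adjC.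
exact: iI.
Qed.

Lemma nbr_neq0 I b : maxindep I -> b \in U :\: I -> nbr I b != set0.
Proof.
move=> [sI /indepP iI mI] /setDP[bU bI]; apply/negP=> /eqP N0.
suff: #|b |: I| <= #|I| by rewrite cardsU1 bI ltnn.
apply: mI; first by rewrite subUset sub1set bU.
apply: indepU1 => [|j jI]; first exact/indepP.
apply/negP=> bj; have : j \in nbr I b by rewrite nbrP jI.
by rewrite N0 inE.
Qed.

Lemma chi_outside I : maxindep I -> k <= chi_set (U :\: I) + 1.
Proof.
move=> [sI iI _]; apply: leq_trans (chi_cover sI) _.
by rewrite leq_add2l chi_set_indep.
Qed.

(** Otherwise {y} dominates everything outside the independent set that consists of [y] and its
    nonneighbours in [I]. *)
Lemma nonneighbour I y : maxindep I -> y \in U :\: I ->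
  exists z, [/\ z \in U :\: I, z != y & ~~ adj y z].
Proof.
move=> mI yUI; apply: NNPP => no; have [sI iI _] := mI; have /setDP[yU yI] := yUI.
have sub : y |: (I :\: nbr I y) \subset U.
  by rewrite subUset sub1set yU (subset_trans _ sI) ?subsetDl.
apply: (@fail1 (y |: (I :\: nbr I y)) [set y]) => //.
- by rewrite sub1set setU11.
- exact: conn1.
- move=> x; rewrite !inE negb_or -!andbA => /and3P[xy xI xU].
  exists y; rewrite ?set11 // adjC; apply: contraT => nyx.
  have [xI'|xI'] := boolP (x \in I); first by rewrite xI' nyx in xI.
  by case: no; exists x; rewrite inE xI' xU.
- apply: leq_trans (chi_cover sub) _; rewrite leq_add2l chi_set_indep //.
  apply: indepU1 => [|j]; first by apply: indepS iI; apply: subsetDl.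
  by rewrite !inE => /andP[]; rewrite negb_and; case: (j \in I).
Qed.

Lemma nbr_meets I b c : maxindep I -> b \in U :\: I -> c \in U :\: I ->
  ~~ adj b c -> exists2 j, j \in nbr I b & j \in nbr I c.
Proof.
move=> mI bU cU nbc; have [_ iI _] := mI.
have /set0Pn[j jb] := nbr_neq0 mI bU; have /set0Pn[i ic] := nbr_neq0 mI cU.
by case: (nested iI nbc) => /subsetP s; [exists j|exists i]; rewrite ?s.
Qed.

(** Otherwise [y] with its neighbours in [I] is a possible part: a vertex outside [I] not adjacent
    to [y] shares one of these neighbours. *)
Lemma outside_critical I y : maxindep I -> y \in U :\: I ->
  chi_set ((U :\: I) :\ y) + 2 <= k.
Proof.
move=> mI yUI; rewrite addn2 leqNgt; apply/negP=> lt; have [sI iI _] := mI.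
have /setDP[yU yI] := yUI.
have e : (U :\: I) :\ y = U :\: (y |: I).
  by apply/setP=> x; rewrite !inE negb_or andbA.
apply: (@fail1 (y |: I) (y |: nbr I y)).
- by rewrite subUset sub1set yU.
- by rewrite setUS ?nbr_sub.
- exact: nbr_conn.
- move=> b; rewrite -e => /setD1P[by_ bUI].
  have [|nby] := boolP (adj b y); first by exists y; rewrite ?setU11.
  have [j jb jy] := nbr_meets mI bUI yUI nby; exists j; first by rewrite inE jy orbT.
  by move: jb; rewrite nbrP => /andP[].
- by rewrite -e addn1.
Qed.

(** Let [a] have the fewest neighbours in [I]. If there are at least two, [i] and [j] among them,
    and [d] is a nonneighbour of [a], the parts are [d] with its neighbours in [I] other than [i],
    and {a, i}. *)
Lemma pendant_exists I : maxindep I -> U :\: I != set0 ->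
  exists a i, a \in U :\: I /\ nbr I a = [set i].
Proof.
move=> mI /set0Pn[a0 a0U]; have [sI iI _] := mI.
case: (@arg_minnP _ a0 (mem (U :\: I)) (fun b => #|nbr I b|)) => // a aUI amin.
have [c1|c1] := leqP #|nbr I a| 1.
  have : #|nbr I a| == 1 by rewrite eqn_leq c1 card_gt0 nbr_neq0.
  by case/cards1P=> i ei; exists a, i.
exfalso; have [d [dUI da nad]] := nonneighbour mI aUI.
have /setDP[aU aI] := aUI; have /setDP[dU dI] := dUI.
have /set0Pn[i ia] := nbr_neq0 mI aUI.
have sad : nbr I a \subset nbr I d.
  case: (nested iI nad) => // s.
  have /eqP-> // : nbr I d == nbr I a; by rewrite eqEcard s amin.
have [j /setD1P[ji ja]] : exists j, j \in nbr I a :\ i.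
  by apply/set0Pn; rewrite -card_gt0; move: c1; rewrite (cardsD1 i (nbr I a)) ia.
have id := subsetP sad _ ia; have jd := subsetP sad _ ja.
have ad x y : x \in nbr I y -> adj y x by rewrite nbrP => /andP[].
have inI x y : x \in nbr I y -> x \in I by rewrite nbrP => /andP[].
have sR : [set a; d] :|: I \subset U by rewrite !subUset !sub1set aU dU.
apply: (@fail2 ([set a; d] :|: I) (d |: (nbr I d :\ i)) [set a; i]) => //.
- apply/subsetP=> x /setU1P[->|/setD1P[_ /inI xI]]; first by rewrite !inE eqxx orbT.
  by rewrite inE xI orbT.
- by apply/subsetP=> x /set2P[]->; rewrite !inE ?eqxx ?(inI _ _ ia) ?orbT.
- by apply: nbr_conn (subsetDl _ _).
- by apply: conn2; apply: ad.
- apply: disjI => x /setU1P[->|/setD1P[xi /inI xI]] /set2P[] e.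
  + by rewrite e eqxx in da.
  + by rewrite e (inI _ _ ia) in dI.
  + by rewrite -e xI in aI.
  + by rewrite e eqxx in xi.
- move=> x /set2P[]->.
    by exists j; [rewrite inE in_setD1 ji jd orbT | apply: ad].
  by exists d; [rewrite setU11 | rewrite adjC; apply: ad].
- move=> b; rewrite !inE !negb_or -!andbA => /and4P[ba bd bI bU].
  have bUI : b \in U :\: I by rewrite inE bI.
  have [|nbd] := boolP (adj b d); first by exists d; rewrite ?setU11.
  case: (nested iI nbd) => /subsetP s.
    have : nbr I b :\ i != set0.
      rewrite -card_gt0; have := leq_trans c1 (amin b bUI).
      by rewrite (cardsD1 i (nbr I b)); case: (i \in _) => //; apply: ltnW.
    case/set0Pn=> l /setD1P[li lb]; exists l; last exact: ad.
    by rewrite inE in_setD1 li s ?orbT.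
  by exists j; [rewrite inE in_setD1 ji jd orbT | apply/ad/s].
- move=> b; rewrite !inE !negb_or -!andbA => /and4P[ba bd bI bU].
  have bUI : b \in U :\: I by rewrite inE bI.
  have [|nba] := boolP (adj b a); first by exists a; rewrite ?set21.
  exists i; rewrite ?set22 //; apply: ad.
  case: (nested iI nba) => [s|/subsetP/(_ _ ia) //].
  by have /eqP-> // : nbr I b == nbr I a; rewrite eqEcard s amin.
- apply: leq_trans (chi_cover sR) _; rewrite leq_add2l.
  apply: leq_trans (chi_setU _ _) _.
  by apply: (@leq_add _ _ 1 1); apply: chi_set_indep => //; apply: indep2.
Qed.

Lemma nbr_adj I b j : j \in nbr I b -> adj b j.
Proof. by rewrite nbrP => /andP[]. Qed.

Lemma nbr_in I b j : j \in nbr I b -> j \in I.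
Proof. by rewrite nbrP => /andP[]. Qed.

Lemma pendant_in I a i : nbr I a = [set i] -> i \in nbr I a.
Proof. by move=> ->; rewrite set11. Qed.

Lemma pendant_nadj I a i j : nbr I a = [set i] -> j \in I -> j != i -> ~~ adj a j.
Proof.
by move=> ea jI ji; apply: contra ji => aj; rewrite -in_set1 -ea nbrP jI.
Qed.

Lemma maxindep_swap I a i : maxindep I -> a \in U :\: I -> nbr I a = [set i] ->
  maxindep (a |: I :\ i).
Proof.
move=> [sI iI mI] /setDP[aU aI] ea; have iI' := nbr_in (pendant_in ea).
split.
- by rewrite subUset sub1set aU (subset_trans _ sI) ?subsetDl.
- apply: indepU1 => [|j /setD1P[ji jI]]; first exact: indepS (subsetDl _ _) iI.
  exact: pendant_nadj ea jI ji.
move=> J sJ iJ; apply: leq_trans (mI J sJ iJ) _.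
by rewrite cardsU1 in_setD1 (negPf aI) andbF (cardsD1 i) iI'.
Qed.

(** Otherwise [b] could be added to the maximum independent set with [a] in place of [i]. *)
Lemma pendant_clique I a b i : maxindep I -> a \in U :\: I -> b \in U :\: I ->
  nbr I a = [set i] -> nbr I b = [set i] -> a != b -> adj a b.
Proof.
move=> mI aU bU ea eb ab; apply: contraT => nab.
have [sI' iI' mI'] := maxindep_swap mI aU ea.
have /setDP[bU' bI] := bU; suff: #|b |: (a |: I :\ i)| <= #|a |: I :\ i|.
  by rewrite (cardsU1 b) !inE eq_sym (negPf ab) (negPf bI) andbF ltnn.
apply: mI'; first by rewrite subUset sub1set bU'.
apply: indepU1 => // j /setU1P[->|/setD1P[ji jI]]; first by rewrite adjC.
exact: pendant_nadj eb jI ji.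
Qed.

(* The parts are {i, a, e}, then d with its other neighbours in I. *)
Lemma no_pendant_triple I a d e i : maxindep I ->
  a \in U :\: I -> d \in U :\: I -> e \in U :\: I ->
  a != d -> a != e -> d != e -> ~~ adj a d -> ~~ adj a e -> ~~ adj d e ->
  nbr I a = [set i] -> nbr I d \subset nbr I e -> False.
Proof.
move=> mI aUI dUI eUI ad ae de nad nae nde ea sde; have [sI iI _] := mI.
have /setDP[aU aI] := aUI; have /setDP[dU dI] := dUI; have /setDP[eU eI] := eUI.
have iI' := nbr_in (pendant_in ea); have ai := nbr_adj (pendant_in ea).
have meet b : b \in U :\: I -> ~~ adj a b -> i \in nbr I b.
  by move=> bU nab; have [j] := nbr_meets mI aUI bU nab; rewrite ea => /set1P->.
have id := meet d dUI nad; have ie := subsetP sde _ id.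
(* With [i] as its only neighbour in [I], [d] would be adjacent to [a] by [pendant_clique]. *)
have [j /setD1P[ji jd]] : exists j, j \in nbr I d :\ i.
  apply/set0Pn/eqP=> e0; move/negP: nad; apply.
  apply: (pendant_clique mI aUI dUI ea) ad; apply/eqP; rewrite eq_sym eqEsubset sub1set id /=.
  apply/subsetP=> x xd; rewrite inE; apply: contraT => xi.
  have : x \in nbr I d :\ i by rewrite in_setD1 xi.
  by rewrite e0 inE.
have je := subsetP sde _ jd; have jI := nbr_in jd.
have sR : [set a; d; e] :|: I \subset U by rewrite !subUset !sub1set aU dU eU.
apply: (@fail2 ([set a; d; e] :|: I) [set i; a; e] (d |: (nbr I d :\ i))) => //.
- by apply/subsetP=> x; rewrite !inE -!orbA => /or3P[]/eqP->; rewrite ?eqxx ?iI' ?orbT.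
- apply/subsetP=> x /setU1P[->|/setD1P[_ /nbr_in xI]]; first by rewrite !inE eqxx orbT.
  by rewrite inE xI orbT.
- rewrite -setUA; apply: conn_star => x /set2P[]->; rewrite adjC //; exact: nbr_adj ie.
- by apply: nbr_conn (subsetDl _ _).
- apply: disjI => x + /setU1P[xd|/setD1P[xi /nbr_in xI]]; rewrite !inE -!orbA => /or3P[]/eqP exx.
  + by rewrite -xd exx iI' in dI.
  + by rewrite -xd exx eqxx in ad.
  + by rewrite -xd exx eqxx in de.
  + by rewrite exx eqxx in xi.
  + by rewrite -exx xI in aI.
  + by rewrite -exx xI in eI.
- move=> x /setU1P[->|/setD1P[xi xd]].
    by exists i; rewrite ?(nbr_adj id) // !inE eqxx.
  by exists e; rewrite ?(adjC x) ?(nbr_adj (subsetP sde _ xd)) // !inE eqxx orbT.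
- move=> b; rewrite !inE !negb_or -!andbA => /and5P[ba bd be bI bU].
  have [|nba] := boolP (adj b a); first by exists a; rewrite // !inE eqxx orbT.
  exists i; first by rewrite !inE eqxx.
  by apply: nbr_adj (meet b _ _); rewrite 1?inE ?bI // adjC.
- move=> b; rewrite !inE !negb_or -!andbA => /and5P[ba bd be bI bU].
  have bUI : b \in U :\: I by rewrite inE bI.
  have [|nbd] := boolP (adj b d); first by exists d; rewrite ?setU11.
  have [/existsP[l /and3P[lb ld li]]|no] := boolP [exists l, [&& l \in nbr I b, l \in nbr I d & l != i]].
    by exists l; [rewrite inE in_setD1 li ld orbT | apply: nbr_adj lb].
  (* Now [i] is the only neighbour of [b] in [I], so [b] is adjacent to [a], and the edges a b and d
     j form an induced 2K2. *)
  exfalso; have no' l : l \in nbr I b -> l \in nbr I d -> l = i.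
    move=> lb ld; apply/eqP; apply: contraT => li; case/negP: no.
    by apply/existsP; exists l; rewrite lb ld.
  have eb : nbr I b = [set i].
    case: (nested iI nbd) => /subsetP s; last by have := no' j (s _ jd) jd => e0; rewrite e0 eqxx in ji.
    apply/eqP; rewrite eqEsubset; apply/andP; split.
      by apply/subsetP=> l lb; rewrite (no' l lb (s _ lb)) set11.
    have /set0Pn[l lb] := nbr_neq0 mI bUI.
    by rewrite sub1set -{1}(no' l lb (s _ lb)).
  have ab : adj a b by apply: pendant_clique mI aUI bUI ea eb _; rewrite eq_sym.
  apply: (twoK2F ab (nbr_adj jd)) => //; exact: pendant_nadj jI ji.
- apply: leq_trans (chi_cover sR) _; rewrite leq_add2l.
  apply: leq_trans (chi_setU _ _) _.
  by apply: (@leq_add _ _ 1 1); apply: chi_set_indep => //; apply: indep3.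
Qed.

(* Descent on the size of the neighbourhood of y1 in I, where I varies too: a
   vertex b with neighbourhood {j} can replace j in I. Otherwise the parts are
   {y2, y3} + S2 and {y1} + S1. *)
Lemma no3_outside I : maxindep I -> no3 (U :\: I).
Proof.
move=> mI y1 y2 y3; move: {2}#|nbr I y1|.+1 (ltnSn #|nbr I y1|) => n.
elim: n I mI y1 y2 y3 => [//|n IHn] I mI y1 y2 y3 le y1U y2U y3U n12 n13 n23 a12 a13 a23.
have [sI iI _] := mI.
(* By the descent, no member of an independent triple outside [I] has fewer neighbours in [I] than
   [y1]. *)
have y1min b c d : b \in U :\: I -> c \in U :\: I -> d \in U :\: I ->
    b != c -> b != d -> c != d -> ~~ adj b c -> ~~ adj b d -> ~~ adj c d ->
    #|nbr I y1| <= #|nbr I b|.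
  move=> bU cU dU bc bd cd nbc nbd ncd; rewrite leqNgt; apply/negP=> lt.
  by apply: (IHn I mI b c d) => //; apply: leq_trans lt _.
have [c1|c1] := leqP #|nbr I y1| 1.
  have : #|nbr I y1| == 1 by rewrite eqn_leq c1 card_gt0 nbr_neq0.
  have [a32 n32] : ~~ adj y3 y2 /\ y3 != y2 by rewrite adjC eq_sym.
  case/cards1P=> i ei; case: (nested iI a23) => s.
    exact: (no_pendant_triple mI y1U y2U y3U n12 n13 n23 a12 a13 a23 ei s).
  exact: (no_pendant_triple mI y1U y3U y2U n13 n12 n32 a13 a12 a32 ei s).
have sub2 : nbr I y1 \subset nbr I y2.
  case: (nested iI a12) => // s.
  have /eqP-> // : nbr I y2 == nbr I y1.
  by rewrite eqEcard s (y1min y2 y1 y3) // 1?eq_sym 1?adjC.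
have sub3 : nbr I y1 \subset nbr I y3.
  case: (nested iI a13) => // s.
  have /eqP-> // : nbr I y3 == nbr I y1.
  by rewrite eqEcard s (y1min y3 y1 y2) // 1?eq_sym 1?adjC // 1?eq_sym.
have /set0Pn[j j1] := nbr_neq0 mI y1U.
have j2 := subsetP sub2 _ j1; have j3 := subsetP sub3 _ j1; have jI := nbr_in j1.
have /setDP[u1 i1] := y1U; have /setDP[u2 i2] := y2U; have /setDP[u3 i3] := y3U.
(* Such a [b] replaces [j] in [I], and [y1] loses a neighbour. If there is none, every nonneighbour
   of [y1] outside [I] has a neighbour in [I] other than [j]. *)
have [/existsP[b /and3P[bUI nyb /eqP eb]]|nob] :=
    boolP [exists b, [&& b \in U :\: I, ~~ adj y1 b & nbr I b == [set j] ]].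
  have mI' := maxindep_swap mI bUI eb.
  have out y : y \in U :\: I -> nbr I y1 \subset nbr I y -> y \in U :\: (b |: I :\ j).
    case/setDP=> yU yI sy; rewrite !inE yU (negPf yI) andbF orbF andbT.
    apply: contraTneq c1 => ebb; rewrite -leqNgt.
    by have := subset_leq_card sy; rewrite ebb eb cards1.
  apply: (IHn _ mI' y1 y2 y3) => //; try exact: out.
  rewrite ltnS in le; apply: leq_trans le; apply: proper_card; rewrite properE.
  apply/andP; split.
    apply/subsetP=> x; rewrite !nbrP => /andP[/setU1P[->|/setD1P[_ ->]] //].
    by rewrite (negPf nyb).
  apply/subsetPn; exists j => //; rewrite nbrP !inE eqxx orbF.
  have /setDP[_ bI] := bUI; apply: contra bI => /andP[/eqP<- _] //.
have [l /setD1P[lj l1]] : exists l, l \in nbr I y1 :\ j.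
  by apply/set0Pn; rewrite -card_gt0; move: c1; rewrite (cardsD1 j (nbr I y1)) j1.
have l2 := subsetP sub2 _ l1.
have sR : [set y1; y2; y3] :|: I \subset U by rewrite !subUset !sub1set u1 u2 u3.
(* [j] goes to the part of [y2] and [y3], where it connects [y3] and dominates [y1]; the other
   neighbours of [y1] stay with [y1]. *)
pose S1 := nbr I y1 :\ j; pose S2 := nbr I y2 :\: S1.
have jS2 : j \in S2 by rewrite !inE eqxx /= -nbrP.
apply: (@fail2 ([set y1; y2; y3] :|: I) (y3 |: (y2 |: S2)) (y1 |: S1)) => //.
- apply/subsetP=> x; rewrite !in_setU1 => /or3P[/eqP->|/eqP->|/setDP[/nbr_in xI _]];
    by rewrite !inE ?eqxx ?xI ?orbT.
- apply/subsetP=> x /setU1P[->|/setD1P[_ /nbr_in xI]]; first by rewrite !inE eqxx.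
  by rewrite inE xI orbT.
- apply: (@conn_add _ _ j); [|by rewrite inE jS2 orbT|exact: nbr_adj j3].
  by apply: nbr_conn (subsetDl _ _).
- by apply: nbr_conn (subsetDl _ _).
- apply: disjI => x; rewrite !in_setU1 => xF /orP[/eqP e|xS1]; move: xF.
    by rewrite e (negPf n12) (negPf n13) /= => /setDP[/nbr_in xI]; rewrite xI in i1.
  case/or3P=> [/eqP e|/eqP e|]; last by rewrite inE xS1.
    by move: xS1; rewrite e => /setD1P[_ /nbr_in xI]; rewrite xI in i3.
  by move: xS1; rewrite e => /setD1P[_ /nbr_in xI]; rewrite xI in i2.
- move=> x /setU1P[->|/setD1P[_ x1]].
    by exists j; [rewrite !in_setU1 jS2 !orbT | apply: nbr_adj j1].
  exists y2; first by rewrite !inE eqxx orbT.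
  by rewrite adjC; apply/nbr_adj/(subsetP sub2).
- move=> b; rewrite !inE !negb_or -!andbA => /and5P[b1 b2 b3 bI bU].
  have bUI : b \in U :\: I by rewrite inE bI.
  have [|nb2] := boolP (adj b y2); first by exists y2; rewrite // !inE eqxx orbT.
  have [|nb3] := boolP (adj b y3); first by exists y3; rewrite // !inE eqxx.
  have mb := y1min b y2 y3 bUI y2U y3U b2 b3 n23 nb2 nb3 a23.
  case: (nested iI nb2) => /subsetP s; last first.
    by exists j; [rewrite !in_setU1 jS2 !orbT | apply/nbr_adj/s].
  have : ~~ (nbr I b \subset S1).
    apply/negP=> /subset_leq_card; apply/negP; rewrite -ltnNge; apply: leq_trans mb.
    by rewrite (cardsD1 j (nbr I y1)) j1.
  case/subsetPn=> x xb xS; exists x; last exact: nbr_adj xb.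
  by rewrite 2!in_setU1 inE xS s ?orbT.
- move=> b; rewrite !inE !negb_or -!andbA => /and5P[b1 b2 b3 bI bU].
  have bUI : b \in U :\: I by rewrite inE bI.
  have [|nb1] := boolP (adj b y1); first by exists y1; rewrite // !inE eqxx.
  case: (nested iI nb1) => /subsetP s; last first.
    by exists l; [rewrite !inE lj -nbrP l1 orbT | apply/nbr_adj/s].
  have [/existsP[x /andP[xb xj]]|no] := boolP [exists x, (x \in nbr I b) && (x != j)].
    by exists x; [rewrite !inE xj -nbrP s ?orbT | apply: nbr_adj xb].
  case/negP: nob; apply/existsP; exists b; rewrite bUI adjC nb1 /=.
  have xj x : x \in nbr I b -> x = j.
    move=> xb; apply/eqP; apply: contraT => xj; case/negP: no.
    by apply/existsP; exists x; rewrite xb.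
  rewrite eqEsubset sub1set; have /set0Pn[x xb] := nbr_neq0 mI bUI.
  rewrite -{2}(xj x xb) xb andbT; apply/subsetP=> z zb; by rewrite (xj z zb) set11.
- apply: leq_trans (chi_cover sR) _; rewrite leq_add2l.
  apply: leq_trans (chi_setU _ _) _.
  by apply: (@leq_add _ _ 1 1); apply: chi_set_indep => //; apply: indep3.
Qed.

(** With nothing outside [I], [U] is independent and at most one part is needed. *)
Lemma maxindep_exists : exists2 I, maxindep I & U :\: I != set0.
Proof.
have [I /andP[sI iI] mI] : {I : {set G} | (I \subset U) && indep I &
    forall J : {set G}, (J \subset U) && indep J -> #|J| <= #|I|}.
  case: (@arg_maxnP _ set0 [pred J : {set G} | (J \subset U) && indep J] (fun J => #|J|)) => [|I].
    by rewrite /= sub0set; apply/indepP=> x; rewrite inE.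
  by exists I.
exists I; first by split=> // J sJ iJ; apply: mI; rewrite sJ.
apply/negP=> e; have sUI : U \subset I by rewrite -setD_eq0.
have iU : indep U by apply: indepS sUI iI.
have [U0|[x xU]] := set_0Vmem U; first by apply: noU; rewrite U0 chi_set0; apply: dm0.
apply: (@fail1 U [set x]); rewrite ?sub1set //; first exact: conn1.
  by move=> y; rewrite setDv inE.
by rewrite setDv chi_set0 chi_set_indep.
Qed.

(** If [z] were the only one, [y] would be complete to the rest X of W = U - I. Then chi(W - z)
    exceeds chi(X), while {y, z} and X colour W with chi(X) + 1 colours, so removing [z] would not
    lower chi(W). *)
Lemma second_nonneighbour I y z : maxindep I -> y \in U :\: I -> z \in U :\: I ->
  y != z -> ~~ adj y z ->
  exists x, [/\ x \in U :\: I, x != y, x != z & ~~ adj y x].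
Proof.
move=> mI yW zW yz nyz; apply: NNPP => no.
pose W := U :\: I; pose X := W :\ z :\ y.
have full : {in [set y] & X, forall x x', adj x x'}.
  move=> x x' /set1P-> /setD1P[xy /setD1P[xz xW]]; apply: contraT => nxy.
  by case: no; exists x'.
have e1 : [set y] :|: X = W :\ z by rewrite setD1K // !inE yz -in_setD.
have e2 : W \subset [set y; z] :|: X.
  by apply/subsetP=> x xW; rewrite !inE -in_setD xW andbT; case: (x == y); case: (x == z).
have := chi_set_join full; rewrite e1.
have := chi_set_sub e2; have := chi_set_indepU X (indep2 nyz).
have := chi_set1 y; have := outside_critical mI zW; have := chi_outside mI.
rewrite -/W -/X -/k; lia.
Qed.

(** * The co-component of a pendant vertex *)

Section Pendant.
Variables (I : {set G}) (a i : G).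
Hypotheses (mI : maxindep I) (aW : a \in U :\: I) (ea : nbr I a = [set i]).

Let W := U :\: I.
(** The component of [a] in the complement of G[U - I]; [rest_a] is complete to it. *)
Definition comp_a := [set x in W | connect (coadj W) a x].
Definition rest_a := W :\: comp_a.
Let C := comp_a.
Let O := rest_a.
Definition core := [set b in C | nbr I b == [set i]].
Definition K := i |: core.
Definition M := C :\: core.
Definition J := i |: C.
Definition I0 := I :\ i.

Lemma iI : i \in I. Proof. exact: nbr_in (pendant_in ea). Qed.

Lemma in_C x : (x \in C) = (x \in W) && connect (coadj W) a x.
Proof. by rewrite in_set. Qed.

Lemma CW : C \subset W. Proof. by apply/subsetP=> x; rewrite in_C => /andP[]. Qed.

Lemma OW : O \subset W. Proof. exact: subsetDl. Qed.

Lemma CO_W : C :|: O = W.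
Proof.
by apply/setP=> x; rewrite in_setU in_setD; case: (boolP (x \in C)) => // /(subsetP CW)->.
Qed.

Lemma aC : a \in C. Proof. by rewrite in_C aW connect0. Qed.

Lemma comp_step x y : x \in C -> y \in W -> ~~ adj x y -> y \in C.
Proof.
rewrite !in_C => /andP[xW cx] yW nxy; rewrite yW /=.
have [<- //|xy] := eqVneq x y.
by apply: connect_trans cx _; apply: connect1; rewrite /coadj xW yW xy.
Qed.

Lemma CO_adj : {in C & O, forall x y, adj x y}.
Proof.
move=> x y xC /setDP[yW yC]; apply: contraT => nxy.
by rewrite (comp_step xC yW nxy) in yC.
Qed.

Lemma coadjC S : symmetric (coadj S).
Proof. by move=> x y; rewrite /coadj andbCA eq_sym adjC. Qed.

Lemma C_conn : {in C &, forall x y, connect (coadj C) x y}.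
Proof.
have from_a x : x \in C -> connect (coadj C) a x.
  rewrite in_C => /andP[_ /connectP[p]].
  elim/last_ind: p x => [|p y IHp] x /=; first by move=> _ ->; rewrite connect0.
  rewrite rcons_path last_rcons => /andP[ap py] ->.
  apply: connect_trans (IHp _ ap erefl) (connect1 _).
  have /and4P[lW yW ly nly] := py.
  have lC : last a p \in C by rewrite in_C lW; apply/connectP; exists p.
  by rewrite /coadj lC (comp_step lC yW nly) ly.
move=> x y xC yC; apply: connect_trans (from_a y yC).
by rewrite (sym_connect_sym (@coadjC C)) from_a.
Qed.

Lemma C_no3 : no3 C. Proof. exact: no3S CW (no3_outside mI). Qed.

Lemma CO_disj x : x \in C -> x \in O -> False.
Proof. by move=> xC /setDP[_]; rewrite xC. Qed.

(** [C :\ y] and [O] are completely joined, so their chromatic numbers add up. *)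
Lemma C_critical y : y \in C -> chi_set (C :\ y) + chi_set O + 2 <= k.
Proof.
move=> yC; have yW : y \in W by apply: (subsetP CW).
apply: leq_trans (outside_critical mI yW); rewrite leq_add2r.
apply: leq_trans (chi_set_join _) _.
  by move=> x z /setD1P[_ xC] zO; apply: CO_adj.
apply: chi_set_sub; rewrite -/W -CO_W; apply/subsetP=> x.
case/setUP=> [/setD1P[xy xC]|xO]; first by rewrite in_setD1 in_setU xy xC.
rewrite in_setD1 in_setU xO orbT andbT; apply: contraTneq xO => ->.
by apply/negP; apply: CO_disj.
Qed.

Lemma O_critical y : y \in O -> chi_set C + chi_set (O :\ y) + 2 <= k.
Proof.
move=> yO; have yW : y \in W by apply: (subsetP OW).
apply: leq_trans (outside_critical mI yW); rewrite leq_add2r.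
apply: leq_trans (chi_set_join _) _.
  by move=> x z xC /setD1P[_ zO]; apply: CO_adj.
apply: chi_set_sub; rewrite -/W -CO_W; apply/subsetP=> x.
case/setUP=> [xC|/setD1P[xy xO]]; last by rewrite in_setD1 in_setU xy xO orbT.
rewrite in_setD1 in_setU xC andbT; apply: contraTneq xC => ->.
by apply/negP=> yC; apply: (CO_disj yC).
Qed.

Lemma k_CO : k <= chi_set C + chi_set O + 1.
Proof.
apply: leq_trans (chi_outside mI) _.
by rewrite leq_add2r -/W -CO_W chi_setU.
Qed.

(** Gallai's lemma gives one inequality; for the other, [C :\ a] has at most two vertices per colour
    and needs fewer than chi(C) colours. *)
Lemma C_card : 2 * chi_set C = #|C|.+1.
Proof.
apply/eqP; rewrite eqn_leq; apply/andP; split.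
  apply: gallai C_no3 _ C_conn => y yC.
  by have := C_critical yC; have := k_CO; lia.
have n3 : no3 (C :\ a) by apply: no3S C_no3; apply: subsetDl.
have := chi_set_half n3; have := C_critical aC; have := k_CO.
rewrite (cardsD1 a C) aC; lia.
Qed.

(** chi(X + O) is at least |X|/2 + chi(O), and k is at most chi(C) + chi(O) + 1 with 2 chi(C) = |C|
    + 1; parity gives the last unit. *)
Lemma lower_bound X p : no3 X -> {in X & O, forall x y, adj x y} ->
  #|C| + 2 <= #|X| + 2 * p -> k <= chi_set (X :|: O) + p.
Proof.
move=> n3 XO le; have := chi_set_join XO; have := chi_set_half n3.
have := C_card; have := k_CO; lia.
Qed.

(** With [a] in place of [i], the independent pair {i, y} with C - a and O - y would cover
    everything outside the new set, in too few colours by the criticality of [C] and [O]. *)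
Lemma i_O y : y \in O -> adj i y.
Proof.
move=> yO; apply: contraT => niy.
have mI' := maxindep_swap mI aW ea.
have sub : U :\: (a |: I :\ i) \subset [set i; y] :|: ((C :\ a) :|: (O :\ y)).
  apply/subsetP=> x; rewrite in_setD in_setU1 in_setD1 negb_or => /andP[/andP[xa xI] xU].
  rewrite !in_setU !in_setD1 xa !in_set1; case: eqP xI => //= xi xI.
  have : x \in W by rewrite inE xI.
  by rewrite -CO_W => /setUP[->|->]; rewrite ?orbT ?andbT ?orbN ?orbT //=; case: (x == y); rewrite ?orbT.
have := chi_set_sub sub; have := chi_set_indepU ((C :\ a) :|: (O :\ y)) (indep2 niy).
have := chi_setU (C :\ a) (O :\ y); have := chi_outside mI'.
have := C_critical aC; have := O_critical yO; have := k_CO; rewrite -/k; lia.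
Qed.

Lemma J_O : {in J & O, forall x y, adj x y}.
Proof. by move=> x y /setU1P[->|xC] yO; [apply: i_O | apply: CO_adj]. Qed.

(** * The partition of J into K and M *)

Lemma iC : i \notin C.
Proof. by apply/negP=> /(subsetP CW); rewrite inE iI. Qed.

Lemma K_M : K :|: M = J.
Proof.
apply/setP=> x; rewrite in_setU 2!in_setU1 in_setD -orbA; congr orb.
by rewrite [x \in core]inE; case: (x \in C) => //=; case: eqP.
Qed.

Lemma iK : i \in K. Proof. exact: setU11. Qed.

Lemma aK : a \in K. Proof. by rewrite in_setU1 [a \in core]inE aC ea eqxx orbT. Qed.

Lemma ai : a != i. Proof. by apply: contraTneq aC => ->; apply: iC. Qed.

Lemma K_notM x : x \in K -> x \in M -> False.
Proof.
move=> xK /setDP[xC nx]; case/setU1P: xK => [e|xc]; last by rewrite xc in nx.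
by have := iC; rewrite -e xC.
Qed.

Lemma K_other x : x \in K -> exists2 y, y \in K & y != x.
Proof.
move=> xK; have [->|nx] := eqVneq x i; first by exists a; [exact: aK|exact: ai].
by exists i; [exact: iK|rewrite eq_sym].
Qed.

Lemma core_W b : b \in core -> b \in W.
Proof. by rewrite inE => /andP[/(subsetP CW)]. Qed.

Lemma core_nbr b : b \in core -> nbr I b = [set i].
Proof. by rewrite inE => /andP[_ /eqP]. Qed.

Lemma K_clique : {in K &, forall x y, x != y -> adj x y}.
Proof.
move=> x y /setU1P[->|xc] /setU1P[->|yc] xy; first by rewrite eqxx in xy.
- by rewrite adjC; apply: nbr_adj (pendant_in (core_nbr yc)).
- by apply: nbr_adj (pendant_in (core_nbr xc)).
- by apply: pendant_clique mI (core_W xc) (core_W yc) (core_nbr xc) (core_nbr yc) xy.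
Qed.

Lemma K_I0 : {in K & I0, forall x w, ~~ adj x w}.
Proof.
move=> x w /setU1P[->|xc] /setD1P[wi wI]; last exact: pendant_nadj (core_nbr xc) wI wi.
by have [_ /indepP iI' _] := mI; apply: iI'; rewrite ?iI.
Qed.

Lemma I0_indep : indep I0.
Proof. by have [_ iI' _] := mI; apply: indepS iI'; apply: subsetDl. Qed.

Lemma M_C v : v \in M -> v \in C. Proof. by case/setDP. Qed.

Lemma M_W v : v \in M -> v \in W. Proof. by move/M_C/(subsetP CW). Qed.

Lemma nbr0_ex b : b \in C -> nbr I b != [set i] -> nbr I0 b != set0.
Proof.
move=> bC; apply: contraNneq => e0.
have bW := subsetP CW _ bC; have /set0Pn[j jb] := nbr_neq0 mI bW.
have ji x : x \in nbr I b -> x = i.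
  move=> xb; apply/eqP; apply: contraT => xi.
  have : x \in nbr I0 b by rewrite nbrP in_setD1 xi (nbr_in xb) (nbr_adj xb).
  by rewrite e0 inE.
rewrite eqEsubset sub1set -{2}(ji j jb) jb andbT.
by apply/subsetP=> x /ji->; rewrite set11.
Qed.

Lemma M_nbr0 v : v \in M -> nbr I0 v != set0.
Proof.
by case/setDP=> vC; rewrite inE vC /=; apply: nbr0_ex.
Qed.

(** Otherwise the edge x y and an edge from [v] to [I0] form an induced 2K2. *)
Lemma M_one v x y : v \in M -> x \in K -> y \in K -> x != y ->
  adj v x || adj v y.
Proof.
move=> vM xK yK xy; apply: contraT; rewrite negb_or => /andP[nx ny].
have /set0Pn[j jv] := M_nbr0 vM.
exfalso; have jI := nbr_in jv.
by apply: (twoK2F (K_clique xK yK xy) (nbr_adj jv)); first [exact: K_I0 | rewrite adjC].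
Qed.

(* Otherwise the parts v + (its neighbours in I0) and {a, i} are possible. *)
Lemma M_nonK v : v \in M -> exists2 x, x \in K & ~~ adj v x.
Proof.
move=> vM; apply: NNPP => no; have [sI iI' _] := mI.
have Kadj x : x \in K -> adj v x.
  by move=> xK; apply: contraT => nvx; case: no; exists x.
have vW := M_W vM; have /setDP[vU vI] := vW; have /setDP[aU aI] := aW.
have va : v != a by apply: contraTneq aK => <-; apply/negP=> /K_notM; apply.
have sR : [set a; v] :|: I \subset U by rewrite !subUset !sub1set aU vU.
have i_in := iI.
apply: (@fail2 ([set a; v] :|: I) (v |: nbr I0 v) [set a; i]) => //.
- apply/subsetP=> x /setU1P[->|/nbr_in/setD1P[_ xI]]; first by rewrite !inE eqxx orbT.
  by rewrite inE xI orbT.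
- by apply/subsetP=> x /set2P[]->; rewrite !inE ?eqxx ?i_in ?orbT.
- exact: nbr_conn.
- by apply/conn2/nbr_adj/(pendant_in ea).
- apply: disjI => x /setU1P[->|/nbr_in/setD1P[xi xI]] /set2P[] e.
  + by rewrite e eqxx in va.
  + by rewrite e i_in in vI.
  + by rewrite -e xI in aI.
  + by rewrite e eqxx in xi.
- move=> x /set2P[]->; exists v; rewrite ?setU11 // adjC; apply: Kadj; [exact: aK|exact: iK].
- move=> b; rewrite !inE !negb_or -!andbA => /and4P[ba bv bI bU].
  have bW : b \in W by rewrite inE bI.
  have [|nbv] := boolP (adj b v); first by exists v; rewrite ?setU11.
  have bC : b \in C by apply: comp_step (M_C vM) bW _; rewrite adjC.
  have nb : nbr I b != [set i].
    apply: contra nbv => eb; rewrite adjC; apply: Kadj.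
    by rewrite inE [b \in core]inE bC eb orbT.
  have /set0Pn[j jb] := nbr0_ex bC nb; have /set0Pn[l lv] := M_nbr0 vM.
  case: (nested I0_indep nbv) => /subsetP s.
    by exists j; [rewrite inE s ?orbT | apply: nbr_adj jb].
  by exists l; [rewrite inE lv orbT | apply: nbr_adj (s _ lv)].
- move=> b; rewrite !inE !negb_or -!andbA => /and4P[ba bv bI bU].
  have bW : b \in W by rewrite inE bI.
  have [|nba] := boolP (adj b a); first by exists a; rewrite ?set21.
  have [j jb] := nbr_meets mI bW aW nba; rewrite ea => /set1P e.
  by exists i; rewrite ?set22 // -e; apply: nbr_adj jb.
- apply: leq_trans (@lower_bound (C :\ a :\ v) 2 _ _ _) _.
  + by apply: no3S C_no3; apply: subset_trans (subsetDl _ _) (subsetDl _ _).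
  + by move=> x y /setD1P[_ /setD1P[_ xC]]; apply: CO_adj.
  + rewrite (cardsD1 a C) aC (cardsD1 v (C :\ a)) in_setD1 va (M_C vM).
    by rewrite /= !add1n addn2 (addnC _ (2 * 2)).
  rewrite leq_add2r; apply: chi_set_sub; apply/subsetP=> x.
  case/setUP=> [/setD1P[xv /setD1P[xa xC]]|xO].
    by have /setDP[xU xI] := subsetP CW _ xC; rewrite !inE (negPf xv) (negPf xa) (negPf xI).
  have /setDP[xU xI] := subsetP OW _ xO; rewrite !inE (negPf xI) xU orbF andbT.
  by apply/norP; split; apply: contraTneq xO => ->; apply/negP; apply: CO_disj;
    [exact: aC|exact: M_C].
Qed.

(** Every vertex of [K] can take the place of [i], so facts about [I] carry over to x + I0. *)
Lemma K_maxindep x : x \in K -> maxindep (x |: I0).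
Proof.
case/setU1P=> [->|xc]; first by rewrite /I0 setD1K ?iI.
exact: maxindep_swap mI (core_W xc) (core_nbr xc).
Qed.

Lemma J_sub_U : J \subset U.
Proof.
have [sI _ _] := mI; rewrite subUset sub1set (subsetP sI _ iI) /=.
by apply: subset_trans CW _; apply: subsetDl.
Qed.

Lemma J_notI0 x : x \in J -> x \in I0 -> False.
Proof.
case/setU1P=> [->|xC] /setD1P[xi xI]; first by rewrite eqxx in xi.
by have /setDP[_] := subsetP CW _ xC; rewrite xI.
Qed.

Lemma J_outside x y : x \in J -> y != x -> y \in J -> y \in U :\: (x |: I0).
Proof.
move=> xJ yx yJ; rewrite inE (subsetP J_sub_U _ yJ) andbT in_setU1 (negPf yx) /=.
by apply/negP; apply: J_notI0.
Qed.

Lemma outside_J x y : x \in K -> y \in U :\: (x |: I0) -> y \notin O -> y \in J.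
Proof.
move=> xK; rewrite !in_setD in_setU1 in_setD1 negb_or => /andP[/andP[yx yI] yU] yO.
rewrite in_setU1; case: eqP yI => //= _ yI.
by apply: contraT => yC; move: yO; rewrite yI yU yC.
Qed.

Lemma KJ x : x \in K -> x \in J. Proof. by rewrite -K_M in_setU => ->. Qed.
Lemma MJ x : x \in M -> x \in J. Proof. by rewrite -K_M in_setU => ->; rewrite orbT. Qed.

Lemma J_cases x : x \in J -> x \in K \/ x \in M.
Proof. by rewrite -K_M => /setUP. Qed.

(** Let the nonneighbour [x] of [v] in [K] take the place of [i]: then [v] has a nonneighbour
    outside x + I0, which is not in [K] by [M_one]. *)
Lemma M_nonM v : v \in M -> exists u, [/\ u \in M, u != v & ~~ adj v u].
Proof.
move=> vM; have [x xK nvx] := M_nonK vM.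
have vx : v != x by apply: contraTneq xK => <-; apply/negP=> /K_notM; apply.
have [u [uW uv nvu]] := nonneighbour (K_maxindep xK) (J_outside (KJ xK) vx (MJ vM)).
have uO : u \notin O by apply: contra nvu => /J_O->//; apply: MJ.
case: (J_cases (outside_J xK uW uO)) => [uK|uM]; last by exists u.
have ux : u != x by case/setDP: uW => _; rewrite in_setU1 negb_or => /andP[].
by have := M_one vM uK xK ux; rewrite (negPf nvu) (negPf nvx).
Qed.

(** This is [second_nonneighbour] for y + I0, where [y] is another vertex of [K]. *)
Lemma K_two x v : x \in K -> v \in M -> ~~ adj x v ->
  exists u, [/\ u \in M, u != v & ~~ adj x u].
Proof.
move=> xK vM nxv; have [y yK yx] := K_other xK.
have vy : v != y by apply: contraTneq yK => <-; apply/negP=> /K_notM; apply.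
have vx : x != v by apply: contraTneq xK => ->; apply/negP=> /K_notM; apply.
have xy : x != y by rewrite eq_sym.
have := second_nonneighbour (K_maxindep yK) (J_outside (KJ yK) xy (KJ xK))
  (J_outside (KJ yK) vy (MJ vM)) vx nxv.
case=> u [uW ux uv nxu].
have uO : u \notin O by apply: contra nxu => /J_O->//; apply: KJ.
case: (J_cases (outside_J yK uW uO)) => [uK|uM]; last by exists u.
by move: nxu; rewrite K_clique // eq_sym.
Qed.

(** At most one of [x], [y], [z] is in the clique [K], which has at least two vertices; so some [t]
    in [K] differs from all three, and [no3_outside] applies to t + I0. *)
Lemma J_no3 : no3 J.
Proof.
move=> x y z xJ yJ zJ xy xz yz nxy nxz nyz.
have [t tK [tx ty tz]] : exists2 t, t \in K & [/\ x != t, y != t & z != t].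
  have notK2 u v : u != v -> ~~ adj u v -> u \in K -> v \notin K.
    by move=> uv nuv uK; apply: contra nuv => vK; apply: K_clique.
  have [xK|nxK] := boolP (x \in K).
    have [t tK tx] := K_other xK; exists t => //; rewrite eq_sym tx.
    by split=> //; [have := notK2 _ _ xy nxy xK|have := notK2 _ _ xz nxz xK];
      apply: contraNneq => ->.
  have [yK|nyK] := boolP (y \in K).
    have [t tK ty] := K_other yK; exists t => //; rewrite [y == t]eq_sym ty.
    split=> //; first by apply: contraNneq nxK => ->.
    by have := notK2 _ _ yz nyz yK; apply: contraNneq => ->.
  have [zK|nzK] := boolP (z \in K).
    have [t tK tz] := K_other zK; exists t => //; rewrite [z == t]eq_sym tz.
    by split=> //; [apply: contraNneq nxK|apply: contraNneq nyK] => ->.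
  by exists i; [exact: iK|split; apply: contraTneq iK => <-].
have tJ := KJ tK.
by apply: (no3_outside (K_maxindep tK) (x := x) (y := y) (z := z)) => //; apply: J_outside.
Qed.

Lemma M_neq0 : exists v, v \in M.
Proof.
have [v [vW va nav]] := nonneighbour mI aW.
exists v; rewrite inE (comp_step aC vW nav) andbT.
by apply: contra nav => vc; apply: K_clique; rewrite ?aK // 1?eq_sym // inE vc orbT.
Qed.

(** * Counting conditions in J *)

Lemma J_card : #|J| = #|C|.+1.
Proof. by rewrite cardsU1 iC. Qed.

Lemma J_even : ~~ odd #|J|.
Proof. by rewrite J_card -C_card mul2n odd_double. Qed.

Lemma U_split : U = I0 :|: J :|: O.
Proof.
have [sI _ _] := mI; apply/setP=> x.
rewrite in_setU (in_setU x I0) [x \in J]in_setU1 [x \in I0]in_setD1 -!orbA.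
have -> : (x \in C) || (x \in O) = (x \in W) by rewrite -CO_W in_setU.
rewrite /W in_setD; have := subsetP sI x; have := iI.
by case: eqP => [-> ->|_ _] /=; case: (x \in I) => // ->.
Qed.

Lemma lower_boundJ X p : X \subset J -> #|J| + 1 <= #|X| + 2 * p ->
  k <= chi_set (X :|: O) + p.
Proof.
move=> sX le; apply: lower_bound.
- exact: no3S sX J_no3.
- by move=> x y xX; apply: J_O; apply: (subsetP sX).
- by move: le; rewrite J_card; lia.
Qed.

Lemma KM_neq x v : x \in K -> v \in M -> x != v.
Proof. by move=> xK vM; apply: contraTneq xK => ->; apply/negP=> /K_notM; apply. Qed.

Lemma rest_cases Y x : x \in U :\: (I0 :|: Y) ->
  [\/ x \in O, x \in K /\ x \notin Y | x \in M /\ x \notin Y].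
Proof.
rewrite in_setD in_setU negb_or => /andP[/andP[x0 xY]].
rewrite U_split in_setU in_setU (negPf x0) /= => /orP[/J_cases[]|]; by [constructor 2|constructor 3|constructor 1].
Qed.

Lemma rest_bound Y p : Y \subset J -> #|Y| + 1 <= 2 * p ->
  k <= chi_set (U :\: (I0 :|: Y)) + p.
Proof.
move=> sY le; apply: leq_trans (@lower_boundJ (J :\: Y) p _ _) _.
- exact: subsetDl.
- by have := cardsID Y J; rewrite (setIidPr sY); lia.
rewrite leq_add2r; apply: chi_set_sub; rewrite U_split; apply/subsetP=> x.
case/setUP=> [/setDP[xJ xY]|xO].
  rewrite in_setD (in_setU x I0 Y) negb_or xY andbT.
  rewrite (in_setU x (I0 :|: J) O) (in_setU x I0 J) xJ orbT andbT.
  by apply/negP; apply: J_notI0.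
have xW := subsetP OW _ xO; have /setDP[xU xI] := xW.
rewrite in_setD (in_setU x I0 Y) negb_or (in_setU x (I0 :|: J) O) xO orbT andbT.
rewrite [x \in I0]in_setD1 (negPf xI) andbF /=.
apply/negP=> /(subsetP sY)/setU1P[e|xC]; last exact: (CO_disj xC xO).
by rewrite e iI in xI.
Qed.

Lemma I0Y_sub Y : Y \subset J -> I0 :|: Y \subset U.
Proof.
move=> sY; rewrite subUset (subset_trans sY J_sub_U) andbT.
by rewrite U_split -setUA subsetUl.
Qed.

(** * Neighbourhoods of M in I0, and the diameter of the complement *)

Lemma M_triangle z u v : z \in J -> u \in M -> v \in M -> z != u -> z != v ->
  u != v -> ~~ adj z u -> ~~ adj z v -> adj u v.
Proof.
move=> zJ uM vM zu zv uv nu nv; apply: contraT => nuv; exfalso.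
exact: (J_no3 zJ (MJ uM) (MJ vM) zu zv uv nu nv nuv).
Qed.

(** Distinct [v] and [w] would be adjacent, since [J] has no independent triple, and the edges x u
    and v w would form an induced 2K2. This excludes 4-cycles x v u w in the complement. *)
Lemma M_square x u v w : x \in K -> u \in M -> v \in M -> w \in M -> adj x u ->
  ~~ adj x v -> ~~ adj x w -> ~~ adj u v -> ~~ adj u w -> v = w.
Proof.
move=> xK uM vM wM xu xv xw uv uw; apply/eqP; apply: contraT => vw.
have avw := M_triangle (KJ xK) vM wM (KM_neq xK vM) (KM_neq xK wM) vw xv xw.
by case: (twoK2F xu avw).
Qed.

Lemma M_adjK x v u : x \in K -> v \in M -> u \in M -> u != v -> ~~ adj x v ->
  ~~ adj v u -> adj x u.
Proof.
move=> xK vM uM uv nxv; apply: contraNT => nxu.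
rewrite eq_sym in uv.
exact: M_triangle (KJ xK) vM uM (KM_neq xK vM) (KM_neq xK uM) uv nxv nxu.
Qed.

(* The parts are {x, u} + S and {v, w}. *)
Lemma two_pieces x v u S w : x \in K -> v \in M -> u \in M -> ~~ adj x v -> adj x u ->
  S \subset nbr I0 u -> w \in I0 -> w \notin S -> adj w u -> adj w v ->
  (forall c, c \in M -> ~~ adj x c -> ~~ adj u c -> exists2 s, s \in S & adj c s) ->
  (forall b, b \in M -> b != v -> ~~ adj b v -> adj b w) -> False.
Proof.
move=> xK vM uM nxv xu sS wI wS wu wv hitS hitw.
have sI0 s : s \in S -> s \in I0 by move/(subsetP sS)/nbr_in.
have uv : u != v by apply: contraNneq nxv => <-.
have sY : [set x; u; v] \subset J by rewrite !subUset !sub1set KJ // !MJ.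
have notJ s : s \in I0 -> s \notin J by move=> sI; apply/negP=> /J_notI0; apply.
apply: (@fail2 (I0 :|: [set x; u; v]) (u |: (x |: S)) [set v; w]).
- exact: I0Y_sub.
- apply/subsetP=> y /setU1P[->|/setU1P[->|/sI0]]; rewrite !inE ?eqxx ?orbT //.
  by case/andP=> -> ->.
- by apply/subsetP=> y /set2P[]->; rewrite in_setU ?wI // !inE eqxx !orbT.
- apply: conn_star => y /setU1P[->|/(subsetP sS)/nbr_adj //]; by rewrite adjC.
- by apply: conn2; rewrite adjC.
- apply: disjI => y yF /set2P[] e; move: yF; rewrite e !in_setU1.
    rewrite eq_sym (negPf uv) eq_sym (negPf (KM_neq xK vM)) /= => /sI0.
    exact: J_notI0 (MJ vM).
  rewrite (negPf wS) orbF => /orP[]/eqP e'; have := notJ w wI; rewrite e'.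
    by rewrite MJ.
  by rewrite KJ.
- move=> y /set2P[]->; last by exists u; rewrite ?setU11.
  have [|nuv] := boolP (adj v u); first by exists u; rewrite ?setU11.
  rewrite adjC in nuv; have [s sS' vs] := hitS v vM nxv nuv.
  by exists s; rewrite // !in_setU1 sS' !orbT.
- move=> y /rest_cases[yO|[yK yY]|[yM yY]].
  + by exists u; rewrite ?setU11 // adjC; apply: J_O (MJ uM) yO.
  + exists x; first by rewrite !in_setU1 eqxx orbT.
    by apply: K_clique => //; apply: contraNneq yY => ->; rewrite !inE eqxx.
  + have [|nyx] := boolP (adj y x); first by exists x; rewrite // !in_setU1 eqxx orbT.
    have [|nyu] := boolP (adj y u); first by exists u; rewrite ?setU11.
    have [||s sS' ys] := hitS y yM; rewrite 1?adjC //.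
    by exists s; rewrite // !in_setU1 sS' !orbT.
- move=> y /rest_cases[yO|[yK yY]|[yM yY]].
  + by exists v; rewrite ?set21 // adjC; apply: J_O (MJ vM) yO.
  + exists v; rewrite ?set21 // adjC.
    have yx : y != x by apply: contraNneq yY => ->; rewrite !inE eqxx.
    by have := M_one vM yK xK yx; rewrite [adj v x]adjC (negPf nxv) orbF.
  + have [|nyv] := boolP (adj y v); first by exists v; rewrite ?set21.
    exists w; rewrite ?set22 //; apply: hitw => //.
    by apply: contraNneq yY => ->; rewrite !inE eqxx orbT.
- apply: rest_bound => //; rewrite -setUA !cardsU1 cards1.
  by do 2 case: (_ \notin _).
Qed.

(** A second neighbour of [z] in [I0] would make [two_pieces] apply: [w] goes with [z], the other
    neighbours go with [x] and a nonneighbour [u] of [z]. *)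
Lemma nbr0_small x z : x \in K -> z \in M -> ~~ adj x z ->
  (forall b, b \in M -> b != z -> ~~ adj z b -> nbr I0 z \subset nbr I0 b) ->
  exists2 w, w \in I0 & nbr I0 z = [set w].
Proof.
move=> xK zM nxz sub; have /set0Pn[w wz] := M_nbr0 zM.
have [e0|/set0Pn[s /setD1P[sw sz]]] := eqVneq (nbr I0 z :\ w) set0.
  exists w; first exact: nbr_in wz.
  by apply/eqP; rewrite eqEsubset sub1set wz andbT -setD_eq0 e0.
exfalso; have [u [uM uz nzu]] := M_nonM zM.
have xu := M_adjK xK zM uM uz nxz nzu; have szu := sub u uM uz nzu.
apply: (@two_pieces x z u (nbr I0 z :\ w) w) => //.
- by apply: subset_trans szu; apply: subsetDl.
- exact: nbr_in wz.
- by rewrite in_setD1 eqxx.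
- by rewrite adjC; apply: nbr_adj (subsetP szu _ wz).
- by rewrite adjC; apply: nbr_adj wz.
- move=> c cM nxc nuc; exists s; first by rewrite in_setD1 sw.
  rewrite adjC in nzu; rewrite (M_square xK uM cM zM xu nxc nxz nuc nzu); exact: nbr_adj sz.
- move=> b bM bz nbz; rewrite adjC in nbz; exact: nbr_adj (subsetP (sub b bM bz nbz) _ wz).
Qed.

(** [v] can replace [w] in x + I0. If the nonneighbour [b] of [z] in [K] were not [x], then [z], [b]
    and [w] would be an independent triple outside the new set. *)
Lemma pendant0 x v w z : x \in K -> v \in M -> ~~ adj x v -> nbr I0 v = [set w] ->
  z \in M -> ~~ adj w z -> ~~ adj x z.
Proof.
move=> xK vM nxv ev zM nwz; have [b bK nzb] := M_nonK zM.
have [<-|bx] := eqVneq b x; first by rewrite adjC.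
exfalso; have vx : v != x by rewrite eq_sym KM_neq.
have wv : w \in nbr I0 v by rewrite ev set11.
have wI := nbr_in wv; have vw := nbr_adj wv.
have vU := J_outside (KJ xK) vx (MJ vM).
have wx : w != x by apply: contraTneq (KJ xK) => <-; apply/negP=> /J_notI0; apply.
have ev' : nbr (x |: I0) v = [set w].
  rewrite -ev; apply/setP=> y; rewrite !nbrP in_setU1; case: eqP => //= ->.
  by rewrite [adj v x]adjC (negPf nxv) andbF.
have mI' := maxindep_swap (K_maxindep xK) vU ev'.
have zv : z != v by apply: contraNneq nwz => ->; rewrite adjC.
have J_out y : y \in J -> y != v -> y != x -> y \in U :\: (v |: (x |: I0) :\ w).
  move=> yJ yv yx; rewrite in_setD in_setU1 in_setD1 in_setU1 (negPf yv) (negPf yx) /=.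
  rewrite (subsetP J_sub_U _ yJ) andbT; apply/negP=> /andP[_].
  exact: J_notI0.
have w_out : w \in U :\: (v |: (x |: I0) :\ w).
  rewrite in_setD in_setU1 in_setD1 eqxx orbF U_split !in_setU wI /= andbT.
  by apply: contraTneq vw => ->; rewrite adj_irr.
have zx : z != x by rewrite eq_sym KM_neq.
have bv : b != v by rewrite KM_neq.
have zw : z != w by apply: contraTneq (MJ zM) => ->; apply/negP=> /J_notI0; apply.
have bw : b != w by apply: contraTneq (KJ bK) => ->; apply/negP=> /J_notI0; apply.
apply: (no3_outside mI' (J_out z (MJ zM) zv zx) (J_out b (KJ bK) bv bx) w_out) => //.
- by rewrite eq_sym KM_neq.
- by rewrite adjC.
- exact: K_I0.
Qed.

(** A vertex [v] of [M] with fewest neighbours in [I0] has just one, [w]. A nonneighbour [z] of [w]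
    in [M] also has just one, [w2], and then {x, u, w} and {z, w2} contradict [two_pieces]. *)
Lemma M_dominated : exists2 w, w \in I0 & forall v, v \in M -> adj w v.
Proof.
have [v0 v0M] := M_neq0.
case: (@arg_minnP _ v0 (mem M) (fun v => #|nbr I0 v|)) => // v vM vmin.
have [x xK nvx] := M_nonK vM; have nxv : ~~ adj x v by rewrite adjC.
have [|w wI ev] := @nbr0_small x v xK vM nxv.
  move=> b bM bv nvb; case: (nested I0_indep nvb) => // s.
  by have /eqP-> // : nbr I0 b == nbr I0 v; rewrite eqEcard s vmin.
exists w => // z zM; apply: contraT => nwz; exfalso.
have nxz := pendant0 xK vM nxv ev zM nwz.
have hit b : b \in M -> b != z -> ~~ adj z b -> nbr I0 z \subset nbr I0 b.
  move=> bM bz nzb; have xb := M_adjK xK zM bM bz nxz nzb.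
  have wb : adj w b by apply: contraTT xb; apply: pendant0 xK vM nxv ev bM.
  (* [w] is adjacent to [b] but not to [z], which decides the inclusion. *)
  case: (nested I0_indep nzb) => // /subsetP/(_ w).
  by rewrite !nbrP wI adjC wb adjC (negPf nwz) => /(_ isT).
have [w2 w2I ez] := nbr0_small xK zM nxz hit.
have [u [uM uv nvu]] := M_nonM vM; have xu := M_adjK xK vM uM uv nxv nvu.
have w2z : w2 \in nbr I0 z by rewrite ez set11.
have wv : w \in nbr I0 v by rewrite ev set11.
have zw2 := nbr_adj w2z.
apply: (@two_pieces x z u [set w] w2) => //.
- rewrite sub1set nbrP wI adjC; apply: contraTT xu; exact: pendant0 xK vM nxv ev uM.
- by rewrite inE; apply: contraNneq nwz => <-; rewrite adjC.
- apply: contraTT xu; exact: pendant0 xK zM nxz ez uM.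
- by rewrite adjC.
- move=> c cM nxc nuc; exists w; rewrite ?set11 //.
  rewrite adjC in nvu; rewrite (M_square xK uM cM vM xu nxc nxv nuc nvu).
  exact: nbr_adj wv.
- move=> b bM bz nbz; rewrite adjC in nbz; exact: nbr_adj (subsetP (hit b bM bz nbz) _ w2z).
Qed.

(* Otherwise the parts are {c, y}, {x, u} and {v, w}, where x is the nonneighbour
   of c in K, u a nonneighbour of c in M and v another nonneighbour of x in M. *)
Lemma J_diameter c y : c \in M -> y \in J -> y != c -> adj c y ->
  exists z, [/\ z \in J, ~~ adj z c & ~~ adj z y].
Proof.
move=> cM yJ yc acy; apply: NNPP => no.
(* The pair {c, y} dominates all of [J]. *)
have far z : z \in J -> adj z c || adj z y.
  by move=> zJ; apply: contraT; rewrite negb_or => /andP[? ?]; case: no; exists z.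
have [w wI wM] := M_dominated.
have [x xK ncx] := M_nonK cM; have nxc : ~~ adj x c by rewrite adjC.
have xy : adj x y by have := far x (KJ xK); rewrite (negPf nxc).
have [u [uM uc ncu]] := M_nonM cM; have nuc : ~~ adj u c by rewrite adjC.
have uy : adj u y by have := far u (MJ uM); rewrite (negPf nuc).
have xu := M_adjK xK cM uM uc nxc ncu.
have [v [vM vc nxv]] := K_two xK cM nxc.
have neq z t : adj z t -> z != t by apply: contraTneq => ->; rewrite adj_irr.
have vu : adj v u.
  apply: contraT => nvu; rewrite adjC in nvu.
  by rewrite (M_square xK uM vM cM xu nxv nxc nvu nuc) eqxx in vc.
have vc' : adj v c.
  exact: M_triangle (KJ xK) vM cM (KM_neq xK vM) (KM_neq xK cM) vc nxv nxc.
have vy : v != y by apply: contraNneq nxv => ->.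
have xv := KM_neq xK vM; have xc := KM_neq xK cM.
have notJ s z : s \in I0 -> z \in J -> z != s.
  by move=> sI; apply: contraTneq => ->; apply/negP=> /J_notI0; apply.
have sY : [set c; y; x; u; v] \subset J by rewrite !subUset !sub1set yJ (KJ xK) !MJ.
have wJ z : z \in J -> z != w by apply: notJ.
apply: (@fail3 (I0 :|: [set c; y; x; u; v]) [set c; y] [set x; u] [set v; w]).
- exact: I0Y_sub.
- by apply/subsetP=> z /set2P[]->; rewrite in_setU !inE eqxx ?orbT.
- by apply/subsetP=> z /set2P[]->; rewrite in_setU !inE eqxx ?orbT.
- by apply/subsetP=> z /set2P[]->; rewrite in_setU ?wI // !inE eqxx !orbT.
- exact: conn2.
- exact: conn2.
- by apply: conn2; rewrite adjC wM.
- apply: disjI => z /set2P[]-> /set2P[] e.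
  + by rewrite e eqxx in xc.
  + by rewrite e eqxx in uc.
  + by have := neq _ _ xy; rewrite e eqxx.
  + by have := neq _ _ uy; rewrite e eqxx.
- apply: disjI => z /set2P[]-> /set2P[] e.
  + by rewrite e eqxx in vc.
  + by have := wJ c (MJ cM); rewrite e eqxx.
  + by rewrite e eqxx in vy.
  + by have := wJ y yJ; rewrite e eqxx.
- apply: disjI => z /set2P[]-> /set2P[] e.
  + by rewrite e eqxx in xv.
  + by have := wJ x (KJ xK); rewrite e eqxx.
  + by have := neq _ _ vu; rewrite e eqxx.
  + by have := wJ u (MJ uM); rewrite e eqxx.
- by move=> z /set2P[]->; exists y; rewrite ?set22.
- by move=> z /set2P[]->; exists c; rewrite ?set21 ?wM.
- by move=> z /set2P[]->; exists u; rewrite ?set22 ?wM.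
- have domQ z : z \in J -> exists2 t, t \in [set c; y] & adj z t.
    by move=> /far/orP[]; [exists c; rewrite ?set21 | exists y; rewrite ?set22].
  move=> z /rest_cases[zO|[zK _]|[zM _]].
  + by exists c; rewrite ?set21 // adjC; apply: J_O (MJ cM) zO.
  + exact: domQ (KJ zK).
  + exact: domQ (MJ zM).
- move=> z /rest_cases[zO|[zK zY]|[zM zY]].
  + by exists u; rewrite ?set22 // adjC; apply: J_O (MJ uM) zO.
  + exists x; rewrite ?set21 //; apply: K_clique => //.
    by apply: contraNneq zY => ->; rewrite !inE eqxx ?orbT.
  + have [|nzx] := boolP (adj z x); first by exists x; rewrite ?set21.
    have [|nzu] := boolP (adj z u); first by exists u; rewrite ?set22.
    rewrite adjC in nzx; rewrite adjC in nzu.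
    by rewrite (M_square xK uM zM cM xu nzx nxc nzu nuc) !inE eqxx in zY.
- move=> z /rest_cases[zO|[zK zY]|[zM zY]].
  + by exists v; rewrite ?set21 // adjC; apply: J_O (MJ vM) zO.
  + exists v; rewrite ?set21 // adjC.
    have zx : z != x by apply: contraNneq zY => ->; rewrite !inE eqxx ?orbT.
    by have := M_one vM zK xK zx; rewrite [adj v x]adjC (negPf nxv) orbF.
  + by exists w; rewrite ?set22 // adjC wM.
- apply: rest_bound => //.
  apply: leq_trans (_ : 5 + 1 <= _) => //; rewrite leq_add2r.
  rewrite -!setUA !cardsU1 cards1; do 4 case: (_ \notin _) => //=.
Qed.

(** * Fibres over K, counted as in a Moore graph *)

Definition fibre x := [set v in M | ~~ adj x v].

Lemma in_fibre x v : (v \in fibre x) = (v \in M) && ~~ adj x v.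
Proof. by rewrite in_set. Qed.

Lemma fibreP x y v : x \in K -> y \in K -> v \in fibre x -> v \in fibre y -> x = y.
Proof.
move=> xK yK; rewrite !in_fibre => /andP[vM nx] /andP[_ ny].
apply/eqP; apply: contraT => xy; have := M_one vM xK yK xy.
by rewrite ![adj v _]adjC (negPf nx) (negPf ny).
Qed.

Lemma M_fibre v : v \in M -> exists2 x, x \in K & v \in fibre x.
Proof. by move=> vM; have [x xK nvx] := M_nonK vM; exists x; rewrite ?in_fibre ?vM // adjC. Qed.

(** For [y] in [K] and [c] in [M] outside the fibre of [y], this is the only nonneighbour of [c] in
    that fibre; the default does not occur then. *)
Definition mate y c := odflt c [pick z in fibre y | ~~ adj c z].

(** [c] and [y] are adjacent, so [J_diameter] gives a common nonneighbour, and it is not in the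
    clique [K]. *)
Lemma mateP x y c : x \in K -> y \in K -> x != y -> c \in fibre x ->
  (mate y c \in fibre y) && ~~ adj c (mate y c).
Proof.
move=> xK yK xy cx; have := cx; rewrite in_fibre => /andP[cM nxc].
rewrite /mate; case: pickP => [z //|no] /=; exfalso.
have cy : adj c y by have := M_one cM xK yK xy; rewrite [adj c x]adjC (negPf nxc).
have [|z [zJ nzc nzy]] := J_diameter cM (KJ yK) _ cy; first by rewrite KM_neq.
case: (J_cases zJ) => [zK|zM].
  have [e|zy] := eqVneq z y; first by rewrite e adjC cy in nzc.
  by rewrite (K_clique zK yK zy) in nzy.
by have := no z; rewrite /= in_fibre zM /= ![adj _ z]adjC nzy nzc.
Qed.

Lemma mate_uniq y c z : y \in K -> c \in M -> c \notin fibre y ->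
  z \in fibre y -> ~~ adj c z -> z = mate y c.
Proof.
move=> yK cM ncy zy ncz; rewrite /mate; case: pickP => [t /andP[ty nct]|/(_ z)] /=.
  move: ncy zy ty; rewrite !in_fibre cM /= negbK => yc /andP[zM nyz] /andP[tM nyt].
  exact: (M_square yK cM zM tM yc).
by rewrite zy ncz.
Qed.

(* In the complement of G[J], each vertex z <> mate y c of the fibre of y is at
   distance 2 from c, through exactly one vertex mate b c. *)
Lemma fibre_card x y c : x \in K -> y \in K -> x != y -> c \in fibre x ->
  #|fibre y| = #|K|.-1.
Proof.
move=> xK yK xy cx; have := cx; rewrite in_fibre => /andP[cM nxc].
have notfib b : b \in K -> b != x -> c \notin fibre b.
  by move=> bK bx; apply: contra bx => cb; apply/eqP/(fibreP bK xK cb cx).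
(* A bijection from [K :\ x] to the fibre of [y]: [y] stands for [mate y c] itself, any other [b]
   for the vertex reached through [mate b c]. *)
pose f b := if b == y then mate y c else mate y (mate b c).
have hP b : b \in K :\ x -> (mate b c \in fibre b) && ~~ adj c (mate b c).
  by case/setD1P=> bx bK; apply: mateP xK bK _ cx; rewrite eq_sym.
have fE b : b \in K :\ x -> b != y ->
    [/\ f b \in fibre y, ~~ adj (mate b c) (f b) & f b != mate b c].
  move=> bKx by_; have /andP[hb nch] := hP b bKx; have /setD1P[bx bK] := bKx.
  have /andP[fy nf] := mateP bK yK by_ hb.
  rewrite /f (negPf by_); split=> //; apply: contraNneq by_ => e.
  by apply/eqP; apply: (fibreP bK yK hb); rewrite -{1}e.
have fy b : b \in K :\ x -> f b \in fibre y.
  move=> bKx; have [e|by_] := eqVneq b y; last by have [] := fE b bKx by_.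
  by have /andP[] := hP b bKx; rewrite /f e eqxx.
have fibM b z : z \in fibre b -> z \in M by rewrite in_fibre => /andP[].
have cneq b z : b \in K :\ x -> z \in fibre b -> c != z.
  by case/setD1P=> bx bK zb; apply: contraNneq (notfib b bK bx) => ->.
have yKx : y \in K :\ x by rewrite in_setD1 eq_sym xy.
have fy_neq b : b \in K :\ x -> b != y -> f b != f y.
  move=> bKx by_; apply/eqP=> e; have [fby nfb nefb] := fE b bKx by_.
  have /andP[hb nchb] := hP b bKx; have /andP[hy nchy] := hP y yKx.
  have ey : f y = mate y c by rewrite /f eqxx.
  have := M_triangle (MJ cM) (fibM _ _ hb) (fibM _ _ fby) (cneq _ _ bKx hb)
    (cneq _ _ yKx fby).
  by rewrite eq_sym nefb nchb e ey nchy => /(_ isT isT isT); rewrite -ey -e (negPf nfb).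
have f_inj : {in K :\ x &, injective f}.
  move=> b b' bKx b'Kx e; apply/eqP; apply: contraT => bb'; exfalso.
  have [ey|by_] := eqVneq b y.
    have b'y : b' != y by rewrite eq_sym -ey.
    by have := fy_neq b' b'Kx b'y; rewrite -e ey eqxx.
  have [ey|b'y] := eqVneq b' y.
    by have := fy_neq b bKx by_; rewrite e ey eqxx.
  have [fby nfb nefb] := fE b bKx by_; have [fb'y nfb' nefb'] := fE b' b'Kx b'y.
  have /andP[hb nchb] := hP b bKx; have /andP[hb' nchb'] := hP b' b'Kx.
  have /setD1P[bx bK] := bKx; have /setD1P[b'x b'K] := b'Kx.
  have hh : mate b c != mate b' c.
    by apply: contraNneq bb' => eh; apply/eqP/(fibreP bK b'K hb); rewrite eh.
  (* The two mates are adjacent. If [c] is adjacent to [f b], these two edges form an induced 2K2;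
     if not, [c], [mate b c] and [f b] are an independent triple. *)
  have ahh := M_triangle (MJ cM) (fibM _ _ hb) (fibM _ _ hb') (cneq _ _ bKx hb)
    (cneq _ _ b'Kx hb') hh nchb nchb'.
  have [acf|ncf] := boolP (adj c (f b)).
    by apply: (twoK2F acf ahh); rewrite // adjC // e.
  have := M_triangle (MJ cM) (fibM _ _ hb) (fibM _ _ fby) (cneq _ _ bKx hb)
    (cneq _ _ yKx fby).
  by rewrite eq_sym nefb nchb ncf (negPf nfb) => /(_ isT isT isT).
have -> : #|K|.-1 = #|K :\ x| by rewrite (cardsD1 x K) xK.
rewrite -(card_in_imset f_inj); apply: eq_card => z; apply/idP/imsetP; last first.
  by case=> b bKx ->; apply: fy.
move=> zy; have zM := fibM _ _ zy; have zc := cneq _ _ yKx zy.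
have [acz|ncz] := boolP (adj c z); last first.
  exists y => //; rewrite /f eqxx; apply: mate_uniq => //; apply: notfib => //.
  by rewrite eq_sym.
(* A common nonneighbour [q] of [c] and [z] lies in the fibre of some [b] other than [x] and [y],
   and [z] is [f b]. *)
have [|q [qJ nqc nqz]] := J_diameter cM (MJ zM) _ acz; first by rewrite eq_sym.
have qc : q != c by apply: contraNneq nqz => ->.
have qz : q != z by apply: contraNneq nqc => ->; rewrite adjC.
have qM : q \in M.
  case: (J_cases qJ) => // qK; case/eqP: xy.
  have e1 : q = x by apply: (fibreP qK xK _ cx); rewrite in_fibre cM.
  by rewrite -e1; apply: (fibreP qK yK _ zy); rewrite in_fibre zM.
have [b bK qb] := M_fibre qM; have := qb; rewrite in_fibre => /andP[_ nbq].
have bx : b != x.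
  apply: contraNneq nqc => e; rewrite e in nbq.
  exact: M_triangle (KJ xK) qM cM (KM_neq xK qM) (KM_neq xK cM) qc nbq nxc.
have by_ : b != y.
  apply: contraNneq nqz => e; rewrite e in nbq.
  have nyz : ~~ adj y z by move: zy; rewrite in_fibre => /andP[].
  exact: M_triangle (KJ yK) qM zM (KM_neq yK qM) (KM_neq yK zM) qz nbq nyz.
exists b; first by rewrite in_setD1 bx.
rewrite /f (negPf by_).
have <- : q = mate b c by apply: mate_uniq; rewrite ?notfib // adjC.
apply: mate_uniq => //; apply: contra by_ => qy; apply/eqP; exact: (fibreP bK yK qb qy).
Qed.

(** [fibre_card] starts from a vertex in the fibre of another element of [K]; if the known vertex
    lies in the fibre of [y] itself, its mate elsewhere serves. *)
Lemma fibre_cardE y : y \in K -> #|fibre y| = #|K|.-1.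
Proof.
move=> yK; have [v vM] := M_neq0; have [x xK vx] := M_fibre vM.
have [e|xy] := eqVneq x y; last exact: fibre_card xK yK xy vx.
have [z zK zy] := K_other yK; have yz : y != z by rewrite eq_sym.
rewrite e in vx; have /andP[mz _] := mateP yK zK yz vx.
exact: fibre_card zK yK zy mz.
Qed.

(** The fibres partition [M], so |M| = |K| (|K| - 1) and |J| = |K|^2, which is even. *)
Lemma K_even : ~~ odd #|K|.
Proof.
have KM : [disjoint K & M] by apply: disjI => x; apply: K_notM.
have cM : #|M| = #|K| * #|K|.-1.
  pose r v := odflt v [pick x in K | v \in fibre x].
  have rP v : v \in M -> (r v \in K) && (v \in fibre (r v)).
    move=> vM; rewrite /r; case: pickP => [x //|no] /=.
    by have [x xK vx] := M_fibre vM; have := no x; rewrite /= xK vx.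
  rewrite -sum1_card (partition_big r (mem K)) /=; last by move=> v /rP/andP[].
  rewrite -sum_nat_const; apply: eq_bigr => x xK.
  rewrite -(fibre_cardE xK) sum1dep_card; apply: eq_card => v.
  rewrite in_set in_fibre; apply/andP/andP=> [[vM /eqP e]|[vM nv]].
    by have := rP v vM; rewrite e in_fibre => /and3P[].
  split=> //; have /andP[rK vr] := rP v vM; apply/eqP.
  by apply: (fibreP rK xK vr); rewrite in_fibre vM.
have := J_even; rewrite -K_M cardsU disjoint_setI0 // cards0 subn0 cM.
have : 0 < #|K| by rewrite card_gt0; apply/set0Pn; exists i; apply: iK.
by case: #|K| => // n _; rewrite [n.+1.-1]/= -mulnS oddM andbb.
Qed.

(** * The final model *)

Lemma K_pairs n T Z t : T \subset K -> #|T| = n.*2 -> Z \subset M :|: O -> dm Z t ->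
  dm (T :|: Z) (n + t).
Proof.
elim: n T => [|n IHn] T sT cT sZ dZ.
  by rewrite (cards0_eq cT) set0U.
have [p pT] : exists p, p \in T by apply/set0Pn; rewrite -card_gt0 cT.
have [q qT] : exists q, q \in T :\ p.
  by apply/set0Pn; rewrite -card_gt0; move: cT; rewrite (cardsD1 p T) pT doubleS add1n => -[->].
have := qT; rewrite in_setD1 => /andP[qp qT'].
have pK := subsetP sT _ pT; have qK := subsetP sT _ qT'.
pose T' := T :\ p :\ q.
have sT' : T' \subset K.
  by apply: subset_trans sT; apply: subset_trans (subsetDl _ _) (subsetDl _ _).
have cT' : #|T'| = n.*2.
  by move: cT; rewrite (cardsD1 p T) pT (cardsD1 q (T :\ p)) qT doubleS; case.
have d := IHn T' sT' cT' sZ dZ.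
have ZK z : z \in Z -> z \in K -> False.
  move=> /(subsetP sZ)/setUP[zM zK|zO zK]; first exact: K_notM zK zM.
  by have := J_O (KJ zK) zO; rewrite adj_irr.
have -> : T :|: Z = [set p; q] :|: (T' :|: Z).
  by rewrite setUA -[[set p; q] :|: T']setUA (setD1K qT) (setD1K pT).
have pq : p != q by rewrite eq_sym.
(* An edge of [K] dominates the rest of [K], all of [M] by [M_one], and [O]. *)
apply: dm_add d (conn2 (K_clique pK qK pq)) _ _.
  move=> z /setUP[/setD1P[zq /setD1P[zp /(subsetP sT) zK]]|zZ].
    by exists p; rewrite ?set21 //; apply: K_clique.
  case/setUP: (subsetP sZ _ zZ) => [zM|zO].
    by have /orP[] := M_one zM pK qK pq; [exists p|exists q]; rewrite ?set21 ?set22.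
  by exists p; rewrite ?set21 // adjC; apply: J_O (KJ pK) zO.
apply: disjI => z /set2P[]-> /setUP[].
- by rewrite !in_setD1 eqxx andbF.
- by move/ZK; apply.
- by rewrite in_setD1 eqxx.
- by move/ZK; apply.
Qed.

(** Another vertex of [M] with the same nonneighbour in [K]; for [y] in [M], [K_two] provides
    one. *)
Definition sibling y := odflt y [pick u in M | (u != y) &&
  [exists x in K, ~~ adj x y && ~~ adj x u]].

Lemma siblingP y : y \in M -> [/\ sibling y \in M, sibling y != y
  & exists x, [/\ x \in K, ~~ adj x y & ~~ adj x (sibling y)]].
Proof.
move=> yM; rewrite /sibling; case: pickP => [u /and3P[uM uy /existsP[x]]|no] /=.
  by case/and3P=> xK nxy nxu; split=> //; exists x.
have [x xK nyx] := M_nonK yM; rewrite adjC in nyx.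
have [u [uM uy nxu]] := K_two xK yM nyx.
have /negP[] := no u; rewrite /= uM uy /=; apply/existsP; exists x.
by rewrite xK nyx nxu.
Qed.

(** A common nonneighbour [z] would be adjacent to the vertex [x] of [K] that both miss, and
    [M_square] would identify [y] with its sibling. *)
Lemma sibling_dom y z : y \in M -> z \in M -> z != y -> z != sibling y ->
  adj z y || adj z (sibling y).
Proof.
move=> yM zM zy zs; have [sM sy [x [xK nxy nxs]]] := siblingP yM.
apply: contraT; rewrite negb_or => /andP[nzy nzs].
rewrite eq_sym in zy; rewrite adjC in nzy.
have xz := M_adjK xK yM zM _ nxy nzy.
rewrite adjC in nzy; have {}xz : adj x z by apply: xz; rewrite eq_sym.
by have := M_square xK zM yM sM xz nxy nxs nzy nzs => e; rewrite -e eqxx in sy.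
Qed.

Lemma sibling_adj y : y \in M -> adj y (sibling y).
Proof.
move=> yM; have [sM sy [x [xK nxy nxs]]] := siblingP yM.
rewrite eq_sym in sy.
exact: M_triangle (KJ xK) yM sM (KM_neq xK yM) (KM_neq xK sM) sy nxy nxs.
Qed.

(** The parts are pairs in [K], the pairs of [y] and [sibling y] for the nonneighbours [y] of [x] in
    [M], then [x], then a model of [X :|: O]. *)
Lemma conclusion : False.
Proof.
have [x xM] := M_neq0.
pose Y := [set y in M | (y != x) && ~~ adj x y].
have YP y : y \in Y -> [/\ y \in M, y != x & ~~ adj x y].
  by rewrite in_set => /and3P[].
(* If the sibling were also a nonneighbour of [x], [M_square] would equate it with [y]. *)
have sx y : y \in Y -> [/\ sibling y \in M, sibling y != x & sibling y \notin Y].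
  case/YP=> yM yx nxy; have [sM sy [r [rK nry nrs]]] := siblingP yM.
  have ays := sibling_adj yM.
  have six : sibling y != x by apply: contraNneq nxy => <-; rewrite adjC.
  split=> //; rewrite in_set sM six /=; apply/negP=> nxs.
  have rx : adj r x.
    by apply: M_adjK rK yM xM _ nry _; rewrite 1?eq_sym // adjC.
  have e := M_square rK xM yM sM rx nry nrs nxy nxs.
  by rewrite -e eqxx in sy.
(* Two vertices with the same sibling share its nonneighbour in [K], so [M_square] equates them. *)
have s_inj : {in Y &, injective sibling}.
  move=> y y' yY y'Y e; have [yM yx nxy] := YP y yY; have [y'M y'x nxy'] := YP y' y'Y.
  have [sM sy [r [rK nry nrs]]] := siblingP yM.
  have [sM' sy' [r' [rK' nry' nrs']]] := siblingP y'M.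
  have er : r = r'.
    by apply: (@fibreP r r' (sibling y)) => //; rewrite in_fibre sM // e.
  have rx : adj r x.
    by apply: M_adjK rK yM xM _ nry _; rewrite 1?eq_sym // adjC.
  by apply: (M_square rK xM yM y'M rx nry _ nxy nxy'); rewrite er.
pose X := M :\: (Y :|: sibling @: Y) :\ x.
have sXM : X \subset M by apply: subset_trans (subsetDl _ _) (subsetDl _ _).
have XP z : z \in X -> [/\ z \in M, z != x, z \notin Y & z \notin sibling @: Y].
  by case/setD1P=> zx /setDP[zM]; rewrite in_setU negb_or => /andP[].
have sXJ : X \subset J by apply: subset_trans sXM _; rewrite -K_M subsetUr.
have dXO : dm (X :|: O) (chi_set (X :|: O)).
  apply: IHU; rewrite properE; apply/andP; split.
    rewrite subUset (subset_trans sXJ J_sub_U); apply: subset_trans OW _.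
    exact: subsetDl.
  apply/subsetPn; exists i; first exact: (subsetP J_sub_U _ (KJ iK)).
  apply/setUP=> -[/(subsetP sXM)|iO]; first exact: K_notM iK.
  by have := J_O (KJ iK) iO; rewrite adj_irr.
have MO z : z \in M -> z \in O -> False.
  by move=> zM zO; have := J_O (MJ zM) zO; rewrite adj_irr.
have dx : dm (x |: (X :|: O)) (chi_set (X :|: O)).+1.
  apply: dm_add dXO (conn1 x) _ _.
    move=> z /setUP[/XP[zM zx zY _]|zO]; exists x; rewrite ?set11 //.
      by apply: contraNT zY => nzx; rewrite in_set zM zx adjC.
    by rewrite adjC; apply: J_O (MJ xM) zO.
  apply: disjI => z /set1P-> /setUP[/XP[_]|]; first by rewrite eqxx.
  exact: MO.
(* The pairs are added one at a time, for growing subsets of [Y]. *)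
have dY n Y' : Y' \subset Y -> #|Y'| = n ->
    dm ((Y' :|: sibling @: Y') :|: (x |: (X :|: O))) (n + (chi_set (X :|: O)).+1).
  elim: n Y' => [|n IHn] Y' sY' cY'.
    by rewrite (cards0_eq cY') imset0 !set0U.
  have [y yY'] : exists y, y \in Y' by apply/set0Pn; rewrite -card_gt0 cY'.
  have yY := subsetP sY' _ yY'; have [yM yx nxy] := YP y yY.
  have [sM six snY] := sx y yY.
  pose Y1 := Y' :\ y; have sY1 : Y1 \subset Y by apply: subset_trans sY'; apply: subsetDl.
  have d := IHn Y1 sY1; move: d; rewrite /Y1.
  have -> : #|Y' :\ y| = n by move: cY'; rewrite (cardsD1 y Y') yY' => -[].
  rewrite -/Y1 => /(_ erefl) d.
  have nin z : z \in Y1 :|: sibling @: Y1 :|: (x |: (X :|: O)) ->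
      [/\ z != y, z != sibling y & (z \in M) || (z \in O)].
    case/setUP=> [/setUP[zY1|/imsetP[u uY1 ->]]|/setU1P[->|/setUP[zX|zO]]].
    - have /setD1P[zy _] := zY1; have zY := subsetP sY1 _ zY1; have [zM _ _] := YP z zY.
      by split; rewrite ?zM //; apply: contraNneq snY => <-.
    - have /setD1P[uy _] := uY1; have uY := subsetP sY1 _ uY1; have [uM uix unY] := sx u uY.
      split; rewrite ?uM //; first by apply: contraNneq unY => ->.
      by apply: contraNneq uy => /s_inj->.
    - by split; rewrite 1?eq_sym // xM.
    - have [zM zx zY zs] := XP z zX; split; rewrite ?zM //.
        by apply: contraNneq zY => ->.
      by apply: contraNneq zs => ->; apply: imset_f.
    - split; rewrite ?zO ?orbT //; apply: contraTneq zO => ->; apply/negP.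
        exact: MO yM.
      exact: MO sM.
  have -> : Y' :|: sibling @: Y' :|: (x |: (X :|: O)) =
      [set y; sibling y] :|: (Y1 :|: sibling @: Y1 :|: (x |: (X :|: O))).
    have eY : Y' = y |: Y1 by rewrite setD1K.
    by rewrite {1 2}eY imsetU1 [X in X :|: _]setUACA -setUA.
  apply: dm_add d (conn2 (sibling_adj yM)) _ _.
    move=> z /nin[zy zs /orP[zM|zO]].
      by have /orP[] := sibling_dom yM zM zy zs; [exists y|exists (sibling y)];
        rewrite ?set21 ?set22.
    by exists y; rewrite ?set21 // adjC; apply: J_O (MJ yM) zO.
  by apply: disjI => z /set2P[]-> /nin[]; rewrite eqxx.
pose Z := Y :|: sibling @: Y :|: (x |: (X :|: O)).
have sZ : Z \subset M :|: O.
  apply/subsetP=> z; rewrite in_setU.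
  case/setUP=> [/setUP[/YP[->]//|/imsetP[u uY ->]]|/setU1P[->|/setUP[/XP[->]//|->]]].
  - by have [->] := sx u uY.
  - by rewrite xM.
  - by rewrite orbT.
have cK : #|K| = #|K|./2.*2 by rewrite even_halfK // K_even.
have dK := K_pairs (subxx K) cK sZ (dY _ Y (subxx Y) erefl).
apply: dm_small dK _ _.
  rewrite subUset (subset_trans _ J_sub_U) /=; last by rewrite -K_M subsetUl.
  apply: subset_trans sZ _; rewrite subUset (subset_trans _ J_sub_U) /=.
    by apply: subset_trans OW _; apply: subsetDl.
  by rewrite -K_M subsetUr.
(* Outside [X], [J] has at most |K| + 2|Y| + 1 vertices; as [x] is a part with a single vertex, this
   meets the bound of [lower_boundJ]. *)
have le : #|J| + 1 <= #|X| + 2 * (#|K|./2 + #|Y| + 1).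
  have cJ : #|J| <= #|K| + #|M| by rewrite -K_M leq_card_setU.
  have cM := cardsID (Y :|: sibling @: Y) M.
  have cX := cardsD1 x (M :\: (Y :|: sibling @: Y)); rewrite -/X in cX.
  have c1 : #|M :&: (Y :|: sibling @: Y)| <= #|Y :|: sibling @: Y|.
    exact: subset_leq_card (subsetIr _ _).
  have c2 : #|Y :|: sibling @: Y| <= #|Y| + #|sibling @: Y| by apply: leq_card_setU.
  have c3 : #|sibling @: Y| <= #|Y| by apply: leq_imset_card.
  have c4 := leq_b1 (x \in M :\: (Y :|: sibling @: Y)).
  move: cJ cM cX c1 c2 c3 c4 cK; move: #|J| #|K| #|M| #|X| #|Y|.
  move: #|M :&: _| #|M :\: _| #|_ :|: _| #|_ @: _| (nat_of_bool _) => *; lia.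
apply: leq_trans (lower_boundJ sXJ le) _; lia.
Qed.

End Pendant.

(** * The theorem, by induction on the size of the vertex set *)

Lemma minimal_counterexample : False.
Proof.
have [I mI /(pendant_exists mI)[a [i [aW ea]]]] := maxindep_exists.
exact: conclusion mI aW ea.
Qed.

End Minimal.

Lemma dm_chi_set (G : sgraph) (U : {set G}) : free twoK2 G -> dm U (chi_set U).
Proof.
move=> G2; have [n] := ubnP #|U|; elim: n U => // n IHn U ltU.
apply: NNPP => noU; apply: minimal_counterexample G2 _ noU => X /proper_card ltX.
exact/IHn/(leq_trans ltX).
Qed.

Theorem theorem1p3 (G : sgraph) (G_free : free twoK2 G) :
  chi G <= hd G /\ dominating_minor G (chi G).
Proof.
have minor : dominating_minor G (chi G).
  apply: dm_dominating_minor; apply: dm_leq (dm_chi_set _ G_free) _.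
  exact: chi_le_chi_set.
by split=> //; rewrite /hd; case: ex_maxnP => m _; apply.
Qed.
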